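(* Let $q$ be a prime power and let $n$, $k$ and $r$ be positive integers such that $r\mid q^n-1$, $k<n/2$ and there exists a degree $k$ factor of $x^n-1$ in $\mathbb{F}_q[x]$. Let $t$ be a real number such that $t>2n/(n-2k)$. Define $$A_t=\prod_{\substack{\wp<2^t\\ \wp\text{ is prime}}}\frac{2}{\sqrt[t]{\wp}},\qquad U_t(n,k,r)=\left(r\,2^{n-k}A_t\right)^{\frac{2t}{t(n-2k)-2n}},\qquad V_t(n,k,r)=\left(r(n-k+2)A_t\right)^{\frac{2t}{t(n-2k)-2n}}.$$ If $$q\geq\min\left\{U_t(n,k,r),\ \max\left\{(n-k)^2,\,V_t(n,k,r)\right\}\right\},$$ then there exists an $r$-primitive element in $\mathbb{F}_{q^n}$ which is $k$-normal over $\mathbb{F}_q$.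
   Context: $\mathbb{F}_{q^n}$ is the finite field with $q^n$ elements. For a divisor $r$ of $q^n-1$, an element $\alpha \in \mathbb{F}_{q^n}^*$ is $r$-primitive if its multiplicative order is $(q^n-1)/r$. An element $\alpha \in \mathbb{F}_{q^n}$ is $k$-normal over $\mathbb{F}_q$ (where $0\le k\le n-1$) if the greatest common divisor in $\mathbb{F}_{q^n}[x]$ of $x^n-1$ and $g_\alpha(x)=\sum_{i=0}^{n-1}\alpha^{q^i}x^{n-1-i}$ has degree $k$. *)

(* Defs.v *)
From mathcomp Require Import all_boot all_order all_algebra all_field.
From mathcomp Require Import all_classical all_reals all_analysis.

Set Implicit Arguments.
Unset Strict Implicit.
Unset Printing Implicit Defensive.

Import Order.TTheory GRing.Theory Num.Theory.
Local Open Scope ring_scope.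

Section FiniteFieldElements.
Variables (F : finFieldType) (L : fieldExtType F).

(* Here q = #|F|, n = \dim {:L}, so that L has q ^ n elements. *)

(* [d.-primitive_root alpha] says that alpha has multiplicative order
   exactly d > 0; in particular alpha is nonzero. *)
Definition r_primitive (r : nat) (alpha : L) : bool :=
  (r %| #|F| ^ \dim {:L} - 1)%N &&
  ((#|F| ^ \dim {:L} - 1) %/ r).-primitive_root alpha.

Definition g_poly (alpha : L) : {poly L} :=
  \sum_(i < \dim {:L}) alpha ^+ (#|F| ^ i) *: 'X^(\dim {:L} - 1 - i).

(* The size of a nonzero polynomial is its degree plus one; the gcd is nonzero
   because \dim {:L} > 0. *)
Definition k_normal (k : nat) (alpha : L) : bool :=
  (k <= \dim {:L} - 1)%N &&
  (size (gcdp ('X^(\dim {:L}) - 1) (g_poly alpha)) == k.+1).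

End FiniteFieldElements.

Section Bounds.
Variable R : realType.
Implicit Types (t : R) (n k r : nat).

(* The index bound only makes the range finite: every natural number
   p < 2 `^ t is at most the integer part of 2 `^ t. *)
Definition A_ t : R :=
  \prod_(0 <= p < (Num.truncn (2 `^ t : R)).+1 | prime p && (p%:R < 2 `^ t))
     (2 / p%:R `^ (t^-1)).

Definition UV_exponent t n k : R :=
  2 * t / (t * (n%:R - 2 * k%:R) - 2 * n%:R).

Definition U_ t n k r : R :=
  (r%:R * 2 ^+ (n - k) * A_ t) `^ UV_exponent t n k.

Definition V_ t n k r : R :=
  (r%:R * (n - k + 2)%:R * A_ t) `^ UV_exponent t n k.

End Bounds.

(* Main.v *)
Require Import Defs.
From HB Require Import structures.
From mathcomp Require Import all_boot all_order all_algebra all_field.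
From mathcomp Require Import all_classical all_reals all_analysis.
From mathcomp Require Import cyclic ring zify.

(** Write [q = #|F|], [n = \dim {:L}], [Q = q ^ n = #|L|], [m = n - k], and
    [X ^ n - 1 = g * f] with [f] of degree [k] and [g] of degree [m].  The ring
    [F[X]] acts on [L], with ['X] acting as the Frobenius map [a |-> a ^ q]
    ([act]).  An element is k-normal as soon as it is killed by [g] but by no
    proper divisor of [g] ([size_gcd_frob_poly]).  So it suffices to find an
    element of order [M = (Q - 1) / r] in the kernel [V] of [g], which has
    [q ^ m] elements ([card_ker_act]), lying outside the kernel of [g / h] for
    each irreducible factor [h] of [g].

    Both conditions are expressed by weights.  On the multiplicative side,
    elements of order [M] are detected by a nonnegative function which is,
    prime by prime of [M], a combination of averages of multiplicative
    characters ([primitive_weight_exists]).  On the additive side, for each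
    irreducible [h] with kernel of size [Q_h], let [F_h] take the value [1] on
    the kernel of [g / h] and [- 1 / (Q_h - 1)] on the rest of [V]; then the
    indicator of the wanted subset of [V] is at least a combination of products
    [f_S] of functions [F_h], [h] in [S] ([weighted_sieve]).  The main term is
    proportional to [q ^ m], while every sum of [f_S] against a nontrivial
    multiplicative character has absolute value at most [sqrt Q]
    ([char_sum_bound]).  This bound needs no Gauss sums.  The
    functions [f_S] satisfy [f_S * f_S = c f_S] for the convolution of [V], by
    the Chinese remainder theorem for the module [V].  The second moment of
    [T x = \sum_v f_S v * chi (x + v)] over [x] in [L] is elementary, because
    the shifted autocorrelations of a nontrivial character at nonzero shifts are all [- 1].
    Comparing [T] on [V] with the multiple [T 0 * f_S] of [f_S] yields the
    bound.

    Expanding the indicator over all sets [S] of irreducible factors costs a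
    factor [2 ^ m] ([sieve_full]); if [m ^ 2 <= q], keeping only the empty set
    and the singletons costs [m + 2] instead ([sieve_linear]).  Thus an element
    exists if [q ^ (n - 2 k)] is at least the square of [r W 2 ^ m], or if
    [m ^ 2 <= q] and it is at least that of [r W (m + 2)], where [W] is the number of squarefree divisors of [M].
    Finally [W <= A_t M ^ (1 / t)] ([pow2_size_primes_le]) turns this into the
    conditions on [U_t] and [V_t] ([real_threshold_sound]). *)

Set Implicit Arguments.
Unset Strict Implicit.
Unset Printing Implicit Defensive.

Import Order.TTheory GRing.Theory Num.Theory.
Local Open Scope ring_scope.

(** * Sums of a multiplicative character over an additive subgroup *)

Section MulChar.
Variable E : finFieldType.
Implicit Types (chi : E -> algC) (V : {set E}).

(** A multiplicative character of [E], extended by [0] at [0]; the trivial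
    character is the indicator of the nonzero elements. *)
Definition mul_char chi : Prop :=
  [/\ chi 0 = 0, {morph chi : x y / x * y}
    & forall x, x != 0 -> `|chi x| = 1].

Definition nontrivial_char chi : Prop := exists2 x, x != 0 & chi x != 1.

Lemma mul_char1 chi : mul_char chi -> chi 1 = 1.
Proof.
move=> [_ chiM chiN]; have n1 : chi 1 != 0.
  by rewrite -normr_eq0 chiN ?oner_neq0.
by apply: (mulfI n1); rewrite -chiM !mulr1.
Qed.

Lemma mul_charV chi y : mul_char chi -> y != 0 -> (chi y)^* = chi y^-1.
Proof.
move=> chiP y0; have [_ chiM chiN] := chiP.
have n0 : chi y != 0 by rewrite -normr_eq0 chiN // oner_neq0.
apply: (mulfI n0); rewrite -normCK chiN // expr1n -chiM divff //.
by rewrite mul_char1.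
Qed.

Lemma sum_mul_char chi :
  mul_char chi -> nontrivial_char chi -> \sum_x chi x = 0.
Proof.
move=> [_ chiM chiN] [a a0 chia].
have /eqP : \sum_x chi x = chi a * \sum_x chi x.
  rewrite mulr_sumr (reindex_inj (mulfI a0)) /=.
  by apply: eq_bigr => x _; rewrite chiM.
rewrite -{1}[\sum_x _]mul1r -subr_eq0 -mulrBl mulf_eq0 subr_eq0 eq_sym.
by rewrite (negPf chia) => /eqP.
Qed.

(** For [u != 0] the substitution [z = 1 + u / y] turns the autocorrelation into
    the complete sum of [chi] with the term [z = 1] missing. *)
Lemma mul_char_corr chi (u : E) : mul_char chi -> nontrivial_char chi ->
  \sum_y chi (y + u) * (chi y)^* = (u == 0)%:R * #|E|%:R - 1.
Proof.
move=> chiP chiT; have [chi0 chiM chiN] := chiP.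
rewrite (bigD1 0) //= chi0 conjC0 mulr0 add0r.
have [->|u0] := eqVneq u 0.
  rewrite (eq_bigr (fun=> 1)) => [|y y0]; last first.
    by rewrite addr0 -normCK chiN // expr1n.
  have E0 : (0 < #|E|)%N by apply/card_gt0P; exists 0.
  by rewrite sumr_const cardC1 mul1r -(prednK E0) -addn1 natrD addrK addn1.
rewrite mul0r add0r.
have -> : \sum_(y | y != 0) chi (y + u) * (chi y)^*
        = \sum_(y | y != 0) chi (1 + u * y^-1).
  apply: eq_bigr => y y0; rewrite mul_charV // -chiM mulrDl divff //.
have := sum_mul_char chiP chiT; rewrite (bigD1 1) //= mul_char1 // => /eqP.
rewrite addrC addr_eq0 => /eqP <-.
rewrite [RHS](reindex_onto (fun y => 1 + u * y^-1) (fun z => u / (z - 1))).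
  apply: eq_bigl => y; rewrite -[_ != 1]/(~~ _) -[_ == 1]subr_eq0 addrAC subrr add0r.
  rewrite mulf_eq0 (negPf u0) /= invr_eq0.
  have [->|y0] := eqVneq y 0; first by rewrite ?eqxx.
  by rewrite invfM invrK mulrA divff // mul1r eqxx.
by move=> z z1; rewrite invfM invrK mulrA divff // mul1r addrCA subrr addr0.
Qed.

Section Bound.
Variables (V : {set E}) (f chi : E -> algC) (c : algC).
Hypotheses (V0 : 0 \in V) (VB : {in V &, forall x y, x - y \in V}).
Hypotheses (chiP : mul_char chi) (chiT : nontrivial_char chi).
Hypotheses (fR : forall x, f x \is Num.real) (fN : {in V, forall x, f (- x) = f x}).
Hypotheses (f0 : f 0 = 1) (c0 : 0 < c).
Hypothesis ff : {in V, forall u, \sum_(x in V) f x * f (u - x) = c * f u}.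

(* The transform of [f]; the sum to be bounded is [T 0]. *)
Let T x := \sum_(v in V) f v * chi (x + v).

Let fC x : (f x)^* = f x.
Proof. exact/conj_Creal. Qed.

Let VN x : x \in V -> - x \in V.
Proof. by move=> xV; rewrite -sub0r VB. Qed.

Let sumf2 : \sum_(v in V) f v ^+ 2 = c.
Proof.
rewrite -[RHS]mulr1 -f0 -ff //; apply: eq_bigr => x xV.
by rewrite sub0r fN // expr2.
Qed.

Let sumT2 : \sum_x T x * (T x)^* = #|E|%:R * c - (\sum_(v in V) f v) ^+ 2.
Proof.
have -> : \sum_x T x * (T x)^* = \sum_x \sum_(v in V) \sum_(w in V)
    f v * f w * (chi (x + v) * (chi (x + w))^*).
  apply: eq_bigr => x _; rewrite /T mulr_suml; apply: eq_bigr => v _.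
  rewrite rmorph_sum mulr_sumr; apply: eq_bigr => w _.
  by rewrite rmorphM /= fC mulrACA.
rewrite exchange_big /= -{1}sumf2 mulr_sumr expr2 mulr_suml -sumrB.
apply: eq_bigr => v vV; rewrite exchange_big /= mulr_sumr.
rewrite (bigD1 v) //= [in RHS](bigD1 v) //= opprD addrA -sumrN.
have E1 w : \sum_x f v * f w * (chi (x + v) * (chi (x + w))^*)
   = f v * f w * ((v == w)%:R * #|E|%:R - 1).
  rewrite -mulr_sumr -[v == w]subr_eq0 -(mul_char_corr _ chiP chiT).
  congr (_ * _); rewrite [RHS](reindex_inj (addIr w)) /=; apply: eq_bigr => x _.
  by rewrite addrACA subrr addr0 // -addrA [w + _]addrC addrK.
rewrite E1 eqxx mul1r mulrBr mulr1 mulrC expr2; congr (_ + _).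
apply: eq_bigr => w /andP[_ wv]; rewrite E1 eq_sym (negPf wv) mul0r sub0r.
by rewrite mulrN1.
Qed.

Let sumfT : \sum_(x in V) f x * T x = c * T 0.
Proof.
rewrite /T mulr_sumr.
transitivity (\sum_(x in V) \sum_(u in V) f x * f (u - x) * chi u).
  apply: eq_bigr => x xV; rewrite mulr_sumr.
  rewrite [RHS](reindex_inj (addrI x)) /=; apply: eq_big => [v|v vV].
    apply/idP/idP => [vV|vV]; first by rewrite -[v]opprK VB ?VN.
    by rewrite -[v](addKr x) addrC VB.
  by rewrite mulrA addrAC subrr add0r.
rewrite exchange_big; apply: eq_bigr => u uV /=.
by rewrite -mulr_suml ff // mulrA add0r.
Qed.

(** If [f] is real and even on the additive subgroup [V], [f 0 = 1], and [f] is
    a positive multiple of an idempotent for the convolution of [V], then its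
    sum against [chi] is bounded by the square root of the order of the field.
    Convolution with [f] is [c] times a projection of the functions on [V],
    so the bound on the second moment of [T] passes to [T 0]. *)
Lemma char_sum_bound : `|\sum_(v in V) f v * chi v| ^+ 2 <= #|E|%:R.
Proof.
have -> : \sum_(v in V) f v * chi v = T 0.
  by apply: eq_bigr => v _; rewrite add0r.
set l := T 0; rewrite -(ler_pM2l c0).
have fR2 : 0 <= (\sum_(v in V) f v) ^+ 2.
  by rewrite -real_normK ?exprn_ge0 // rpred_sum.
have le1 : \sum_(x in V) T x * (T x)^* <= c * #|E|%:R.
  apply: (@le_trans _ _ (\sum_x T x * (T x)^*)); last first.
    by rewrite sumT2 mulrC lerBlDr lerDl.
  rewrite [leRHS](bigID [in V]) /= lerDl.
  by apply: sumr_ge0 => x _; rewrite -normCK exprn_ge0.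
apply: le_trans le1.
(* Expanding this square gives [c * |l|^2 <= \sum_(x in V) |T x|^2]. *)
have : 0 <= \sum_(x in V) `|T x - l * f x| ^+ 2.
  by apply: sumr_ge0 => x _; rewrite exprn_ge0.
have -> : \sum_(x in V) `|T x - l * f x| ^+ 2 =
   \sum_(x in V) (T x * (T x)^* - l^* * (f x * T x) - l * (f x * T x)^*
     + l * l^* * f x ^+ 2).
  apply: eq_bigr => x _; rewrite normCK rmorphB !rmorphM /= !fC.
  by ring.
rewrite big_split /= !sumrB -!mulr_sumr -rmorph_sum sumfT sumf2 -/l rmorphM /=.
rewrite (conj_Creal (gtr0_real c0)) normCK => H.
rewrite -[_ <= _]subr_ge0; apply: le_trans H _; rewrite le_eqVlt; apply/orP; left.
by apply/eqP; ring.
Qed.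
End Bound.
End MulChar.

(** * Detecting elements of prescribed order by characters *)

Lemma finField_prim_root (E : finFieldType) :
  {g : E | (#|E|.-1).-primitive_root g}.
Proof.
have E1 : (1 < #|E|)%N := finNzRing_gt1 E.
pose rs := enum [pred x : E | x != 0].
have : has (#|E|.-1).-primitive_root rs; last first.
  by move=> /hasP/sig2W[g _ gP]; exists g.
apply: has_prim_root.
- by rewrite -ltnS prednK // ltnW.
- apply/allP => x; rewrite mem_enum inE => x0; rewrite unity_rootE.
  apply/eqP/(mulfI x0); rewrite -exprS prednK ?mulr1 ?expf_card //.
  exact: ltnW.
- exact: enum_uniq.
- by rewrite -cardE cardC1.
Qed.

Lemma sum_unity_root (C : fieldType) (z : C) p : (0 < p)%N -> z ^+ p = 1 ->
  \sum_(a < p) z ^+ a = if z == 1 then p%:R else 0.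
Proof.
move=> p0 zp; case: eqVneq => [->|z1].
  by under eq_bigr do rewrite expr1n; rewrite sumr_const card_ord.
have : (z - 1) * (\sum_(a < p) z ^+ a) = 0 by rewrite -subrX1 zp subrr.
by move=> /eqP; rewrite mulf_eq0 subr_eq0 (negPf z1) => /eqP.
Qed.

Section PrimitiveWeight.
Variables (E : finFieldType) (r M : nat).
Hypothesis cardE : #|E|.-1 = (r * M)%N.

Let N := #|E|.-1.
Let N0 : (0 < N)%N.
Proof. by rewrite -ltnS prednK; rewrite ?finNzRing_gt1 // ltnW // finNzRing_gt1. Qed.
Let r0 : (0 < r)%N.
Proof. by move: N0; rewrite /N cardE muln_gt0 => /andP[]. Qed.
Let M0 : (0 < M)%N.
Proof. by move: N0; rewrite /N cardE muln_gt0 => /andP[]. Qed.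

(* [g] generates the multiplicative group, [z] is a root of unity of the same
   order in [algC], and [chi j] is the character sending [g] to [z ^+ j]. *)
Let g := sval (finField_prim_root E).
Let gP : N.-primitive_root g := svalP (finField_prim_root E).
Let z := sval (C_prim_root_exists N0).
Let zP : N.-primitive_root z := svalP (C_prim_root_exists N0).

Let dlog_subproof (x : E) : x != 0 -> exists i : 'I_N, x == g ^+ i.
Proof.
move=> x0; have /(prim_rootP gP)[i ->] : x ^+ N = 1; last by exists i.
by apply: (mulfI x0); rewrite -exprS prednK ?mulr1 ?expf_card // ltnW // finNzRing_gt1.
Qed.

Let dlog (x : E) : nat := if [pick i : 'I_N | x == g ^+ i] is Some i then i else 0%N.

Let dlogK x : x != 0 -> g ^+ dlog x = x.
Proof.
move=> /dlog_subproof[i0 xi0]; rewrite /dlog; case: pickP => [i /eqP->//|/(_ i0)].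
by rewrite xi0.
Qed.

Let chi (j : nat) (x : E) : algC := if x == 0 then 0 else z ^+ (j * dlog x).

Let chi_char j : mul_char (chi j).
Proof.
split=> [|x y|x x0]; first by rewrite /chi eqxx.
- rewrite /chi mulf_eq0; case: eqVneq => [|x0]; first by rewrite mul0r.
  case: eqVneq => [|y0] /=; first by rewrite mulr0.
  rewrite -exprD -mulnDr; apply/eqP; rewrite (eq_prim_root_expr zP).
  rewrite -modnMmr -[in X in _ == X]modnMmr; apply/eqP; congr ((_ * _) %% _)%N.
  apply/eqP; rewrite -(eq_prim_root_expr gP) exprD !dlogK //.
  by rewrite mulf_eq0 negb_or x0.
rewrite /chi (negPf x0) normrX; apply/eqP.
have: `|z| ^+ N == 1 by rewrite -normrX (prim_expr_order zP) normr1.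
by rewrite pexpr_eq1 // => /eqP ->; rewrite expr1n.
Qed.

Let chi_nontrivial j : ~~ (N %| j)%N -> nontrivial_char (chi j).
Proof.
move=> Nj; have g0 : g != 0.
  apply/eqP => g0; have := prim_expr_order gP.
  rewrite g0 expr0n -[N == _]negbK -lt0n N0 => /eqP.
  by rewrite eq_sym oner_eq0.
exists g => //; rewrite /chi (negPf g0).
have /eqP e : g ^+ dlog g == g ^+ 1 by rewrite dlogK // expr1.
have e2 : z ^+ (j * dlog g) = z ^+ j.
  apply/eqP; rewrite (eq_prim_root_expr zP) -modnMmr.
  have /eqP -> : (dlog g == 1 %[mod N])%N by rewrite -(eq_prim_root_expr gP) e.
  by rewrite modnMmr muln1.
by rewrite e2 -(prim_order_dvd zP).
Qed.

Let chiD j k x : chi (j + k) x = chi j x * chi k x.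
Proof. by rewrite /chi; case: eqP => _; rewrite ?mulr0 // mulnDl exprD. Qed.

(* [ind_r] is the indicator of the nonzero r-th powers.  On these, [theta p] is
   [1] at the (r * p)-th powers and [- 1 / (p - 1)] elsewhere, so that
   [1 - theta p] vanishes exactly at the (r * p)-th powers. *)
Let ind_r x : algC := r%:R^-1 * \sum_(b < r) chi (b * M) x.
Let theta p x : algC := (p.-1)%:R^-1 * \sum_(1 <= a < p) chi (a * (M %/ p)) x.
Let sift ps x : algC := \prod_(p <- ps) (1 - theta p x).
Let weight x : algC := ind_r x * sift (primes M) x.

Let ind_rE x : ind_r x = ((x != 0) && (r %| dlog x)%N)%:R.
Proof.
rewrite /ind_r /chi; case: eqVneq => [|x0] /=; first by rewrite big1 ?mulr0.
have -> : \sum_(b < r) z ^+ (b * M * dlog x) = \sum_(b < r) (z ^+ (M * dlog x)) ^+ b.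
  by apply: eq_bigr => b _; rewrite -exprM -mulnA mulnC.
rewrite sum_unity_root //; last first.
  rewrite -exprM; apply/eqP; rewrite -(prim_order_dvd zP) /N cardE.
  by apply/dvdnP; exists (dlog x); lia.
rewrite -(prim_order_dvd zP) /N cardE [(r * M)%N]mulnC dvdn_pmul2l //.
by case: (r %| _)%N; rewrite ?mulr0 // mulVf // pnatr_eq0 -lt0n.
Qed.

Let thetaE p x : prime p -> (p %| M)%N -> x != 0 -> (r %| dlog x)%N ->
  1 - theta p x = if (r * p %| dlog x)%N then 0 else p%:R / (p.-1)%:R.
Proof.
move=> pp pM x0 rx.
have p1 : (p.-1)%:R != 0 :> algC.
  by rewrite pnatr_eq0; case: p pp {pM} => // -[].
have pn : p%:R = (p.-1)%:R + 1 :> algC.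
  by rewrite -[1]/(1%:R) -natrD addn1 prednK ?prime_gt0.
suff -> : theta p x = (p.-1)%:R^-1 * ((if (r * p %| dlog x)%N then p%:R else 0) - 1).
  by case: ifP => _; rewrite ?pn; field.
congr (_ * _); rewrite /chi (negPf x0).
have -> : \sum_(1 <= a < p) z ^+ (a * (M %/ p) * dlog x) =
  \sum_(a < p) (z ^+ (M %/ p * dlog x)) ^+ a - 1.
  rewrite -(big_mkord xpredT (fun a => (z ^+ (M %/ p * dlog x)) ^+ a)).
  rewrite (big_ltn (prime_gt0 pp)) expr0 [1 + _]addrC addrK.
  by apply: eq_bigr => a _; rewrite -exprM -mulnA mulnC.
congr (_ - _); rewrite sum_unity_root ?prime_gt0 //; last first.
  rewrite -exprM; apply/eqP; rewrite -(prim_order_dvd zP) /N cardE.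
  case/dvdnP: rx => i ->; case/dvdnP: pM => m ->; rewrite mulnK ?prime_gt0 //.
  by apply/dvdnP; exists i; lia.
rewrite -(prim_order_dvd zP) /N cardE.
case/dvdnP: pM => m eM; have m0 : (0 < m)%N by move: M0; rewrite eM; lia.
rewrite eM mulnK ?prime_gt0 //.
by rewrite (_ : (r * (m * p) = m * (r * p))%N) ?dvdn_pmul2l //; lia.
Qed.

Let pfacP p : p \in primes M -> prime p /\ (p %| M)%N.
Proof. by rewrite mem_primes => /and3P[]. Qed.

Let weight_ge0 x : 0 <= weight x.
Proof.
rewrite /weight ind_rE; case: (eqVneq x) => [|x0] /=; first by rewrite mul0r.
case: (boolP (r %| _)%N) => [rx|_]; last by rewrite mul0r.
rewrite mul1r /sift big_seq; apply: prodr_ge0 => p /pfacP[pp pM].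
by rewrite thetaE //; case: ifP => // _; rewrite divr_ge0 ?ler0n.
Qed.

Let weight_prim x : weight x != 0 -> M.-primitive_root x.
Proof.
rewrite /weight ind_rE; case: (eqVneq x) => [|x0] /=; first by rewrite mul0r eqxx.
case: (boolP (r %| _)%N) => [rx|_]; last by rewrite mul0r eqxx.
rewrite mul1r /sift prodf_seq_neq0 => /allP ps.
have xg := exp_prim_root gP (dlog x); rewrite dlogK // in xg.
suff e : gcdn (dlog x) N = r by move: xg; rewrite e {1}/N cardE mulKn.
case/dvdnP: rx => i di; rewrite di /N cardE [(r * M)%N]mulnC -muln_gcdl.
suff -> : gcdn i M = 1%N by rewrite mul1n.
apply/eqP/negPn/negP => gn1; set d := gcdn i M in gn1.
have d0 : (0 < d)%N by rewrite gcdn_gt0 M0 orbT.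
have pp : prime (pdiv d) by apply: pdiv_prime; lia.
have pd := pdiv_dvd d.
have pM : (pdiv d %| M)%N := dvdn_trans pd (dvdn_gcdr _ _).
have pi : (pdiv d %| i)%N := dvdn_trans pd (dvdn_gcdl _ _).
have := ps (pdiv d); rewrite mem_primes pp M0 pM => /(_ isT).
rewrite /= thetaE // di; last exact: dvdn_mull.
by rewrite mulnC dvdn_pmul2r // pi eqxx.
Qed.

Section Functional.
Variables (c : E -> algC) (B : algC).
Hypothesis HB : forall psi, mul_char psi -> nontrivial_char psi ->
  `|\sum_x c x * psi x| <= B.

Let X (phi : E -> algC) := \sum_x c x * phi x.

Let eqX phi psi : phi =1 psi -> X phi = X psi.
Proof. by move=> e; apply: eq_bigr => x _; rewrite e. Qed.

Let XB phi psi : X (fun x => phi x - psi x) = X phi - X psi.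
Proof. by rewrite /X -sumrB; apply: eq_bigr => x _; rewrite mulrBr. Qed.

Let XZ a phi : X (fun x => a * phi x) = a * X phi.
Proof. by rewrite /X mulr_sumr; apply: eq_bigr => x _; rewrite mulrCA. Qed.

Let Xsum (I : Type) (s : seq I) (P : pred I) (F : I -> E -> algC) :
  X (fun x => \sum_(i <- s | P i) F i x) = \sum_(i <- s | P i) X (F i).
Proof.
rewrite /X exchange_big /=; apply: eq_bigr => x _; by rewrite mulr_sumr.
Qed.

Let sift_cons p ps x : sift (p :: ps) x = (1 - theta p x) * sift ps x.
Proof. by rewrite /sift big_cons. Qed.

Let sum_const_le p (F : nat -> algC) C : prime p ->
  (forall a, (0 < a < p)%N -> `|F a| <= C) ->
  `|(p.-1)%:R^-1 * \sum_(1 <= a < p) F a| <= C.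
Proof.
move=> pp FC; have p1 : 0 < (p.-1)%:R :> algC.
  by rewrite ltr0n; case: p pp {FC} => // -[].
rewrite normrM normfV normr_nat mulrC ler_pdivrMr //.
apply: le_trans (ler_norm_sum _ _ _) _.
rewrite big_nat_cond; apply: (@le_trans _ _ (\sum_(1 <= a < p | (0 < a < p)%N && true) C)).
  by apply: ler_sum => a /andP[ha _]; apply: FC.
by rewrite -big_nat_cond sumr_const_nat subn1 mulr_natr.
Qed.

(* The divisor [n] of [M] certifies that [chi j], and all the characters
   produced by expanding the product, are nontrivial. *)
Let sift_bound n ps j : (n %| M)%N ->
  (forall p, p \in ps -> prime p /\ (n %| M %/ p)%N) -> ~~ (n %| j)%N ->
  `|X (fun x => chi j x * sift ps x)| <= 2 ^+ size ps * B.
Proof.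
move=> nM; elim: ps j => [|p ps IH] j psP nj.
  rewrite mul1r (@eqX _ (chi j)) => [|x]; last by rewrite /sift big_nil mulr1.
  apply: HB (chi_char j) (chi_nontrivial _); apply: contra nj.
  by apply: dvdn_trans; rewrite /N cardE dvdn_mull.
have [pp np] := psP p (mem_head _ _).
have {}IH j' : ~~ (n %| j')%N -> `|X (fun x => chi j' x * sift ps x)| <= 2 ^+ size ps * B.
  by apply: IH => p' hp'; apply: psP; rewrite inE hp' orbT.
rewrite (@eqX _ (fun x => chi j x * sift ps x - (p.-1)%:R^-1 *
   \sum_(1 <= a < p) chi (j + a * (M %/ p)) x * sift ps x)); last first.
  move=> x; rewrite sift_cons mulrBl mul1r mulrBr; congr (_ - _).
  rewrite /theta -!mulrA mulrCA; congr (_ * _).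
  rewrite mulrA mulr_sumr mulr_suml; apply: eq_bigr => a _.
  by rewrite chiD.
rewrite XB XZ Xsum exprS -mulrA mulrDl mul1r.
apply: le_trans (ler_normB _ _) _; apply: lerD; first exact: IH.
apply: sum_const_le => // a _; apply: IH.
by rewrite dvdn_addl // dvdn_mull.
Qed.

(* Expanding the factor of one prime [p], the correction terms are nontrivial
   characters because the p-part of [M] does not divide [a * (M %/ p)]. *)
Let sift_ind_bound ps : uniq ps -> (forall p, p \in ps -> prime p /\ (p %| M)%N) ->
  `|X (fun x => ind_r x * sift ps x) - X ind_r| <= (2 ^+ size ps - 1) * B.
Proof.
elim: ps => [|p ps IH] /=.
  move=> _ _; rewrite expr0 subrr mul0r (@eqX _ ind_r) ?subrr ?normr0 // => x.
  by rewrite /sift big_nil mulr1.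
move=> /andP[pps ups] psP.
have psP' p' : p' \in ps -> prime p' /\ (p' %| M)%N.
  by move=> hp'; apply: psP; rewrite inE hp' orbT.
have {}IH := IH ups psP'.
have [pp pM] := psP p (mem_head _ _).
pose n := (p ^ logn p M)%N.
have nM : (n %| M)%N by apply: pfactor_dvdnn.
have lp : (0 < logn p M)%N by rewrite logn_gt0 mem_primes pp M0.
rewrite (@eqX _ (fun x => ind_r x * sift ps x - r%:R^-1 * \sum_(b < r)
   ((p.-1)%:R^-1 * \sum_(1 <= a < p) chi (b * M + a * (M %/ p)) x * sift ps x))).
  rewrite XB addrAC; apply: le_trans (ler_normB _ _) _.
  have -> : 2 ^+ (size ps).+1 - 1 = (2 ^+ size ps - 1) + 2 ^+ size ps :> algC.
    by rewrite exprS; ring.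
  rewrite [leRHS]mulrDl; apply: (lerD IH).
  rewrite XZ Xsum normrM normfV normr_nat mulrC ler_pdivrMr ?ltr0n //.
  apply: le_trans (ler_norm_sum _ _ _) _.
  apply: (@le_trans _ _ (\sum_(b < r) 2 ^+ size ps * B)); last first.
    by rewrite sumr_const card_ord mulr_natr.
  apply: ler_sum => b _; rewrite XZ Xsum; apply: sum_const_le => // a /andP[a0 ap].
  apply: (@sift_bound n) => //.
    move=> p' hp'; have [pp' pM'] := psP' p' hp'; split=> //.
    rewrite -(@Gauss_dvdr _ p') ?[(p' * _)%N]mulnC ?divnK //.
    rewrite coprimeXl // prime_coprime // dvdn_prime2 //.
    by apply: contra pps => /eqP ->.
  rewrite dvdn_addr; last exact: dvdn_mull.
  apply/negP => h.
  have : (n * p %| a * M)%N by rewrite -(divnK pM) mulnA dvdn_pmul2r ?prime_gt0.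
  have aM0 : (0 < a * M)%N by rewrite muln_gt0 a0.
  rewrite mulnC -expnS pfactor_dvdn // lognM // ?M0 // => h2.
  have : (0 < logn p a)%N by lia.
  by rewrite logn_gt0 mem_primes => /and3P[_ _ /dvdn_leq]; lia.
move=> x; rewrite sift_cons mulrBl mul1r mulrBr; congr (_ - _).
rewrite /ind_r /theta -!mulrA; congr (_ * _).
rewrite mulr_suml; apply: eq_bigr => b _.
rewrite mulrCA; congr (_ * _); rewrite mulrA mulr_sumr mulr_suml.
by apply: eq_bigr => a _; rewrite chiD.
Qed.

(** Of the [r] characters averaged in [ind_r] only [chi 0] is trivial: this
    accounts for [r - 1] of the error terms. *)
Lemma weight_bound :
  `|r%:R * X weight - \sum_(x | x != 0) c x|
    <= (r%:R * 2 ^+ size (primes M) - 1) * B.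
Proof.
have e0 : \sum_(x | x != 0) c x = X (chi 0).
  rewrite /X big_mkcond /=; apply: eq_bigr => x _.
  by rewrite /chi; case: eqP; rewrite ?mulr0 // mul0n expr0 mulr1.
have e1 : r%:R * X ind_r - X (chi 0) = \sum_(1 <= b < r) X (chi (b * M)).
  rewrite XZ mulrA divff ?mul1r ?pnatr_eq0 -?lt0n // Xsum.
  rewrite -(big_mkord xpredT (fun b => X (chi (b * M)))) big_ltn // mul0n.
  by rewrite addrC addKr.
rewrite e0 (_ : _ - _ =
  r%:R * (X weight - X ind_r) + (r%:R * X ind_r - X (chi 0))); last by ring.
rewrite (_ : (_ - 1) * B =
  r%:R * ((2 ^+ size (primes M) - 1) * B) + (r%:R - 1) * B); last by ring.
apply: le_trans (ler_normD _ _) _; apply: lerD.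
  rewrite normrM normr_nat ler_wpM2l ?ler0n //.
  by apply: sift_ind_bound (primes_uniq _) _ => p /pfacP.
rewrite e1; apply: le_trans (ler_norm_sum _ _ _) _.
rewrite big_nat; apply: (@le_trans _ _ (\sum_(1 <= b < r) B)).
  rewrite [leRHS]big_nat; apply: ler_sum => b /andP[b0 br].
  apply: HB (chi_char _) (chi_nontrivial _); rewrite /N cardE dvdn_pmul2r //.
  by apply/negP => /dvdn_leq; lia.
by rewrite sumr_const_nat -(mulr_natl B) natrB.
Qed.
End Functional.

(** A nonnegative weight supported on the elements of order [M]: its sum against
    any [c] is, up to the factor [r], the sum of [c] over the nonzero elements,
    with an error controlled by the sums of [c] against nontrivial characters.
    The factor [2 ^+ size (primes M)] is the number of squarefree divisors of
    [M]. *)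
Lemma primitive_weight_exists : exists w : E -> algC,
  [/\ forall x, 0 <= w x, forall x, w x != 0 -> M.-primitive_root x
   & forall (c : E -> algC) (B : algC),
     (forall psi, mul_char psi -> nontrivial_char psi ->
        `|\sum_x c x * psi x| <= B) ->
     `|r%:R * (\sum_x c x * w x) - \sum_(x | x != 0) c x|
       <= (r%:R * 2 ^+ size (primes M) - 1) * B].
Proof.
exists weight; split; [exact: weight_ge0 | exact: weight_prim |].
exact: weight_bound.
Qed.

End PrimitiveWeight.

(** * The weighted sieve *)

Lemma sqrtC_nat_bound (a b e : nat) : (a ^ 2 * e <= b ^ 2)%N ->
  a%:R * sqrtC (e%:R) <= b%:R :> algC.
Proof.
move=> h; have e0 : 0 <= sqrtC (e%:R : algC) by rewrite sqrtC_ge0 ler0n.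
rewrite -(@ler_pXn2r _ 2%N) // ?nnegrE ?ler0n ?mulr_ge0 ?ler0n //.
by rewrite exprMn sqrtCK -!natrX -natrM ler_nat.
Qed.

(** The sieve takes place in an additive subgroup [V] of the field.  The maps
    [pi i] send [V] to subgroups [K i], and [fiber] says that [V] is
    equidistributed in the product of the [K i].  Wanted are the elements of
    order [M] whose images under all the [pi i] are nonzero. *)
Section Sieve.
Variables (E : finFieldType) (r M : nat).
Hypothesis cardE : #|E|.-1 = (r * M)%N.
Variables (V : {set E}) (I : finType) (pi : I -> E -> E) (K : I -> {set E}).
Variable N : nat.
Hypotheses (V0 : 0 \in V) (VB : {in V &, forall x y, x - y \in V}).
Hypothesis piB : forall i, {morph pi i : x y / x - y}.
Hypothesis piK : forall i, {in V, forall v, pi i v \in K i}.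
Hypotheses (K0 : forall i, 0 \in K i).
Hypothesis K_gt1 : forall i, (1 < #|K i|)%N.
Hypothesis fiber : forall z : {ffun I -> E}, (forall i, z i \in K i) ->
  #|[set v in V | [ffun i => pi i v] == z]| = N.

Local Notation Q i := (#|K i|%:R : algC).

Let Q1 i : 1 < Q i.
Proof. by rewrite ltr1n. Qed.
Let Q0 i : Q i != 0.
Proof. exact: lt0r_neq0 (lt_trans ltr01 (Q1 i)). Qed.
Let Qm0 i : Q i - 1 != 0.
Proof. by rewrite subr_eq0 gt_eqF. Qed.

Let pi0 i : pi i 0 = 0.
Proof. by have := piB i 0 0; rewrite !subrr. Qed.

(** By equidistribution, sums over [V] of products factor. *)
Lemma sum_prod_fiber (G : I -> E -> algC) :
  \sum_(v in V) \prod_i G i (pi i v) = N%:R * \prod_i \sum_(z in K i) G i z.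
Proof.
rewrite bigA_distr_big_dep mulr_sumr.
rewrite (partition_big (fun v => [ffun i => pi i v]) [in family (fun i => mem (K i))]) /=.
  apply: eq_bigr => z /familyP zK.
  rewrite (eq_bigr (fun=> \prod_i G i (z i))) => [|v /andP[_ /eqP <-]]; last first.
    by apply: eq_bigr => i _; rewrite ffunE.
  rewrite sumr_const -[LHS]mulr_natl; congr (_%:R * _).
  by rewrite -(fiber zK); apply: eq_card => v; rewrite !inE.
by move=> v vV; apply/familyP => i; rewrite ffunE piK.
Qed.

(** The average of the nontrivial additive characters of the group [K i], given
    by its values. *)
Definition sieve_factor i (z : E) : algC :=
  if z == 0 then 1 else - (Q i - 1)^-1.
Local Notation F := sieve_factor.

Let FE i z : F i z = Q i / (Q i - 1) * (z == 0)%:R - (Q i - 1)^-1.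
Proof. by rewrite /sieve_factor; case: eqP => _ /=; field. Qed.

Let FR i z : F i z \is Num.real.
Proof.
rewrite /sieve_factor; case: eqP => _; first exact: rpred1.
by rewrite rpredN rpredV rpredB ?rpred1 // realn.
Qed.

Let sumK0 i (G : E -> algC) x : x \in K i ->
  \sum_(z in K i) (z == x)%:R * G z = G x.
Proof.
move=> xK; rewrite (bigD1 x) //= eqxx mul1r big1 ?addr0 // => z /andP[_ /negPf->].
by rewrite mul0r.
Qed.

Let sumF i : \sum_(z in K i) F i z = 0.
Proof.
under eq_bigr do rewrite FE mulrC.
rewrite sumrB (sumK0 (fun=> _)) // sumr_const -[X in _ - X]mulr_natl; field.
exact: Qm0.
Qed.

Let convF i x : x \in K i ->
  \sum_(z in K i) F i z * F i (x - z) = Q i / (Q i - 1) * F i x.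
Proof.
move=> xK.
transitivity (\sum_(z in K i) ((z == 0)%:R * (Q i / (Q i - 1) * F i (x - z)) -
   ((z == x)%:R * ((Q i - 1)^-1 * (Q i / (Q i - 1)))  - (Q i - 1)^-1 * (Q i - 1)^-1))).
  apply: eq_bigr => z _; rewrite !FE subr_eq0 [x == z]eq_sym; ring.
rewrite sumrB (sumK0 (fun z => Q i / (Q i - 1) * F i (x - z))) // subr0.
rewrite sumrB (sumK0 (fun=> _)) // sumr_const.
rewrite -[(_ *+ _)%R in X in _ - (_ - X)]mulr_natl; field.
exact: Qm0.
Qed.

(** The products of sieve factors; [sieve_fun set0] is the constant [1]. *)
Definition sieve_fun (S : {set I}) (v : E) : algC := \prod_(i in S) F i (pi i v).

Let sieve_funE S v :
  sieve_fun S v = \prod_i (if i \in S then F i (pi i v) else 1).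
Proof. by rewrite /sieve_fun big_mkcond. Qed.

Let sieve_fun_real S v : sieve_fun S v \is Num.real.
Proof. by apply: rpred_prod => i _; apply: FR. Qed.

Let piN i v : pi i (- v) = - pi i v.
Proof. by rewrite -sub0r piB pi0 sub0r. Qed.

Let sieve_funN S v : sieve_fun S (- v) = sieve_fun S v.
Proof. by apply: eq_bigr => i _; rewrite piN /sieve_factor oppr_eq0. Qed.

Let sieve_fun0 S : sieve_fun S 0 = 1.
Proof. by rewrite /sieve_fun big1 // => i _; rewrite pi0 /sieve_factor eqxx. Qed.

Let N0 : (0 < N)%N.
Proof.
rewrite -(@fiber [ffun=> 0]) => [|i]; last by rewrite ffunE.
apply/card_gt0P; exists 0; rewrite inE V0 /=; apply/eqP/ffunP => i.
by rewrite !ffunE pi0.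
Qed.

Let sieve_fun_conv S : exists2 c : algC, 0 < c &
  {in V, forall u, \sum_(x in V) sieve_fun S x * sieve_fun S (u - x) =
                   c * sieve_fun S u}.
Proof.
exists (N%:R * \prod_i (if i \in S then Q i / (Q i - 1) else Q i)).
  rewrite mulr_gt0 ?ltr0n //; apply: prodr_gt0 => i _.
  have q0 : 0 < Q i := lt_trans ltr01 (Q1 i).
  by case: ifP => // _; rewrite divr_gt0 // subr_gt0.
move=> u uV; transitivity (\sum_(x in V) \prod_i
   (if i \in S then F i (pi i x) * F i (pi i u - pi i x) else 1)).
  apply: eq_bigr => x _; rewrite !sieve_funE -big_split; apply: eq_bigr => i _ /=.
  by case: ifP; rewrite ?mulr1 // piB.
rewrite (sum_prod_fiber (fun i z => if i \in S then F i z * F i (pi i u - z) else 1)).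
rewrite sieve_funE -mulrA -big_split /=; congr (_ * _); apply: eq_bigr => i _.
by case: ifP => _; rewrite ?convF ?piK // sumr_const mulr1.
Qed.

Let sum_sieve_fun S :
  \sum_(v in V) sieve_fun S v = if S == finset.set0 then #|V|%:R else 0.
Proof.
case: eqP => [->|/eqP/set0Pn[i iS]].
  by rewrite -sumr_const; apply: eq_bigr => v _; rewrite /sieve_fun big_set0.
under eq_bigr do rewrite sieve_funE.
rewrite (sum_prod_fiber (fun i z => if i \in S then F i z else 1)).
by rewrite (bigD1 i) //= iS sumF mul0r mulr0.
Qed.

Local Notation B := (sqrtC (#|E|%:R : algC)).
Local Notation W := (2 ^+ size (primes M) : algC).

Let E1 : (1 < #|E|)%N := finNzRing_gt1 E.
Let B1 : 1 < B.
Proof. by rewrite -[X in X < _]sqrtC1 ltr_sqrtC ?ltr1n ?qualifE /= ?ler01 ?ler0n. Qed.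

(** The weights [w] bound from below the indicator of the elements with nonzero
    images; only the empty set contributes to the main term.  The number
    [w set0 * #|V|] then has to be at least [r W sqrt #|E|] times the total mass
    of [w]; equality is allowed because [1 < sqrt #|E|]. *)
Theorem weighted_sieve (w : {set I} -> algC) :
  (forall S, w S \is Num.real) -> 0 < w finset.set0 ->
  {in V, forall v, \sum_S w S * sieve_fun S v <= ([forall i, pi i v != 0])%:R} ->
  r%:R * W * B * (\sum_S `|w S|) <= w finset.set0 * #|V|%:R ->
  exists2 v, v \in V & (forall i, pi i v != 0) /\ M.-primitive_root v.
Proof.
move=> wR w0 wV wB.
have [psi [psi0 psiM psiB]] := primitive_weight_exists cardE.
pose Y S := \sum_(v in V) sieve_fun S v * psi v.
have YR S : Y S \is Num.real.
  by apply: rpred_sum => v _; rewrite rpredM // ger0_real.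
have Yb S : `|r%:R * Y S - (\sum_(v in V) sieve_fun S v - 1)| <= (r%:R * W - 1) * B.
  pose c x := if x \in V then sieve_fun S x else 0.
  have cE (phi : E -> algC) : \sum_x c x * phi x = \sum_(v in V) sieve_fun S v * phi v.
    rewrite [RHS]big_mkcond; apply: eq_bigr => x _.
    by rewrite /c; case: ifP => //; rewrite mul0r.
  have : \sum_(x | x != 0) c x = \sum_(v in V) sieve_fun S v - 1.
    have := cE (fun=> 1); rewrite (bigD1 0) //= /c V0 sieve_fun0 mulr1.
    under [X in _ = X -> _]eq_bigr do rewrite mulr1.
    move=> <-; rewrite [1 + _]addrC addrK; by apply: eq_bigr => x _; rewrite mulr1.
  move=> <-; rewrite /Y -cE; apply: psiB.
  move=> chi chiP chiT; rewrite cE.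
  have [k k0 kP] := sieve_fun_conv S.
  have := char_sum_bound V0 VB chiP chiT (sieve_fun_real S)
    (fun x _ => sieve_funN S x) (sieve_fun0 S) k0 kP.
  rewrite -[X in _ <= X]sqrtCK ler_pXn2r // nnegrE ?normr_ge0 //.
have posr : 0 < \sum_S r%:R * (w S * Y S).
  rewrite (bigD1 finset.set0) //=.
  have lb : - (\sum_(S | S != finset.set0) `|w S| * (r%:R * W * B))
      <= \sum_(S | S != finset.set0) r%:R * (w S * Y S).
    rewrite -sumrN; apply: ler_sum => S S0.
    have real1 : r%:R * (w S * Y S) \is Num.real by rewrite !rpredM // realn.
    have : `|r%:R * (w S * Y S)| <= `|w S| * (r%:R * W * B).
      rewrite mulrCA normrM ler_wpM2l //.
      have := Yb S; rewrite sum_sieve_fun (negPf S0) sub0r opprK => h.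
      rewrite -[r%:R * Y S](addrK 1); apply: le_trans (ler_normB _ _) _.
      rewrite normr1; apply: le_trans (lerD h (ltW B1)) _.
      by rewrite mulrBl mul1r subrK.
    by rewrite (real_ler_norml _ real1) => /andP[].
  have ub : w finset.set0 * (#|V|%:R - r%:R * W * B) < r%:R * (w finset.set0 * Y finset.set0).
    rewrite mulrCA ltr_pM2l //.
    have := Yb finset.set0; rewrite sum_sieve_fun eqxx real_ler_norml; last first.
      by rewrite !rpredB ?rpredM ?realn ?rpred1.
    move=> /andP[h _]; rewrite -(ltrD2r (1 - #|V|%:R)).
    have : - ((r%:R * W - 1) * B) <= r%:R * Y finset.set0 + (1 - #|V|%:R).
      by apply: le_trans h _; rewrite opprB.
    apply: lt_le_trans; rewrite -subr_gt0.
    rewrite (_ : _ - _ = B - 1) ?subr_gt0 //; by ring.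
  apply: le_lt_trans (ltr_leD ub lb).
  rewrite -mulr_suml [X in 0 <= _ - X * _](_ : _ = \sum_S `|w S| - w finset.set0); last first.
    by rewrite [in RHS](bigD1 finset.set0) //= (gtr0_norm w0) addrC addrK.
  move: wB; rewrite -subr_ge0; congr (0 <= _); by ring.
have r0 : 0 < r%:R :> algC.
  rewrite ltr0n lt0n; apply: contraTneq E1 => r0.
  by move: cardE; rewrite r0 mul0n; lia.
case: (pickP [pred v | [&& v \in V, [forall i, pi i v != 0] & psi v != 0]]).
  by move=> v /and3P[vV /forallP piv /psiM vM]; exists v.
move=> none; move: posr; rewrite -mulr_sumr pmulr_rgt0 // => pos.
suff : \sum_S w S * Y S <= 0 by rewrite real_leNgt ?pos // ?rpred0 // gtr0_real.
rewrite (_ : \sum_S w S * Y S = \sum_(v in V) (\sum_S w S * sieve_fun S v) * psi v); last first.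
  rewrite /Y; under eq_bigr do rewrite mulr_sumr.
  rewrite exchange_big /=; apply: eq_bigr => v _; rewrite mulr_suml.
  by apply: eq_bigr => S _; rewrite mulrA.
apply: sumr_le0 => v vV.
apply: le_trans (ler_wpM2r (psi0 v) (wV v vV)) _.
have := none v; rewrite /= vV /=; case: [forall i, _]; last by rewrite mul0r.
by move=> /negbFE/eqP ->; rewrite mulr0.
Qed.

Let Qi_gt0 i : 0 < Q i.
Proof. exact: lt_trans ltr01 (Q1 i). Qed.

(** The exact expansion of the indicator, with weights
    [\prod_i (1 - 1 / Q i) * (-1) ^+ #|S|]. *)
Theorem sieve_full :
  ((r * 2 ^ size (primes M) * 2 ^ #|I|) ^ 2 * #|E| <= #|V| ^ 2)%N ->
  exists2 v, v \in V & (forall i, pi i v != 0) /\ M.-primitive_root v.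
Proof.
move=> /sqrtC_nat_bound hB.
pose rho : algC := \prod_i (1 - (Q i)^-1).
have rho0 : 0 < rho.
  by apply: prodr_gt0 => i _; rewrite subr_gt0 invf_lt1.
apply: (@weighted_sieve (fun S => rho * (-1) ^+ #|S|)).
- by move=> S; rewrite rpredM ?rpredX ?rpredN ?rpred1 // gtr0_real.
- by rewrite cards0 expr0 mulr1.
- move=> v vV; rewrite le_eqVlt; apply/orP; left; apply/eqP.
  transitivity (rho * \prod_i (- F i (pi i v) + 1)).
    rewrite bigA_distr mulr_sumr; apply: eq_bigr => S _; rewrite -mulrA; congr (_ * _).
    rewrite -big_mkcond /= /sieve_fun -prodr_const -big_split /=.
    by apply: eq_bigr => i _; rewrite mulN1r.
  rewrite -big_split /= (eq_bigr (fun i => (pi i v != 0)%:R)) => [|i _].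
    case: forallP => [h|/forallP]; first by rewrite big1 // => i _; rewrite h.
    by rewrite negb_forall => /existsP[i /negbTE e]; rewrite (bigD1 i) //= e mul0r.
  rewrite /sieve_factor; case: eqP => _ /=; first by rewrite addNr mulr0.
  rewrite opprK; field; by rewrite Q0 Qm0.
rewrite (eq_bigr (fun=> rho)) => [|S _]; last first.
  by rewrite normrM normrX normrN1 expr1n mulr1 gtr0_norm.
rewrite sumr_const cards0 expr0 mulr1 -[rho *+ _]mulr_natr mulrCA ler_pM2l //.
apply: le_trans hB; rewrite !natrM !natrX le_eqVlt; apply/orP; left; apply/eqP.
rewrite (_ : #|_| = 2 ^ #|I|)%N; first by rewrite natrX; ring.
by rewrite -cardsT -card_powerset; apply: eq_card => S; rewrite !inE finset.subsetT.
Qed.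

(** The union bound: the indicator is at least
    [(1 - \sum_i 1 / Q i) - \sum_i (1 - 1 / Q i) * F i], and the hypothesis
    [m ^ 2 <= q] makes the total mass of the weights at most [m + 2] times the
    weight [1 - \sum_i 1 / Q i] of the empty set. *)
Theorem sieve_linear (m q : nat) : (1 < m)%N -> (#|I| <= m)%N ->
  (forall i, (q <= #|K i|)%N) -> (m ^ 2 <= q)%N ->
  ((r * 2 ^ size (primes M) * (m + 2)) ^ 2 * #|E| <= #|V| ^ 2)%N ->
  exists2 v, v \in V & (forall i, pi i v != 0) /\ M.-primitive_root v.
Proof.
move=> m1 Im Kq mq /sqrtC_nat_bound hB.
pose sg : algC := \sum_i (Q i)^-1.
have sm : m%:R * sg <= 1.
  rewrite mulr_sumr; apply: (@le_trans _ _ (\sum_(i : I) m%:R^-1)).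
    apply: ler_sum => i _; rewrite ler_pdivrMr // mulrC ler_pdivlMr ?ltr0n 1?ltnW //.
    by rewrite -natrM ler_nat mulnn (leq_trans mq).
  rewrite sumr_const -[_ *+ _]mulr_natl ler_pdivrMr ?ltr0n 1?ltnW //.
  by rewrite mul1r ler_nat.
have mR : 0 < m%:R :> algC by rewrite ltr0n ltnW.
have m1R : 1 < m%:R :> algC by rewrite ltr1n.
have sg1 : 0 < 1 - sg.
  rewrite subr_gt0 -(ltr_pM2l mR) mulr1; exact: le_lt_trans sm m1R.
pose w (S : {set I}) : algC := if S == finset.set0 then 1 - sg else
   if #|S| == 1 then - \sum_(i in S) (1 - (Q i)^-1) else 0.
have wE (G : {set I} -> algC) (h : algC -> algC) : h 0 = 0 ->
   \sum_S h (w S) * G S = h (1 - sg) * G finset.set0 +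
     \sum_i h (- (1 - (Q i)^-1)) * G [set i].
  move=> h0; rewrite (bigD1 finset.set0) //= {1}/w eqxx; congr (_ + _).
  transitivity (\sum_(S : {set I} | #|S| == 1) h (w S) * G S); last first.
    rewrite big_cards1; apply: eq_bigr => i _; rewrite /w cards1 eqxx big_set1.
    by rewrite -cards_eq0 cards1.
  rewrite big_mkcond [RHS]big_mkcond; apply: eq_bigr => S _; rewrite /w -cards_eq0.
  by case: #|S| => [|[|n]] //=; rewrite h0 mul0r.
have QV i : (Q i)^-1 <= 1 by rewrite invf_le1 // ltW.
apply: (@weighted_sieve w).
- move=> S; rewrite /w; case: eqP => _; first exact: gtr0_real.
  case: eqP => _; last exact: rpred0.
  by rewrite rpredN rpred_sum // => i _; rewrite ger0_real // subr_ge0.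
- by rewrite /w eqxx.
- move=> v vV; rewrite (wE _ id) //= /sieve_fun big_set0 mulr1.
  rewrite (_ : 1 - sg + _ = 1 - \sum_i (pi i v == 0)%:R); last first.
    rewrite -addrA; congr (_ + _); rewrite /sg -!sumrN -big_split /=.
    apply: eq_bigr => i _; rewrite big_set1 FE; field; by rewrite Q0 Qm0.
  case: forallP => [h|/forallP]; first by rewrite lerBlDr lerDl sumr_ge0 // => i _; rewrite ler0n.
  rewrite negb_forall => /existsP[i /negPn e]; rewrite subr_le0 (bigD1 i) //= e.
  by rewrite lerDl sumr_ge0 // => j _; rewrite ler0n.
rewrite (eq_bigr (fun S => `|w S| * 1)) => [|S _]; last by rewrite mulr1.
rewrite (wE (fun=> 1) (fun x => `|x|)) ?normr0 // mulr1 /w eqxx gtr0_norm //.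
rewrite (eq_bigr (fun i => 1 - (Q i)^-1)) => [|i _]; last first.
  by rewrite normrN mulr1 ger0_norm // subr_ge0.
rewrite sumrB sumr_const -/sg.
apply: (@le_trans _ _ ((1 - sg) * ((r * 2 ^ size (primes M) * (m + 2))%:R * sqrtC #|E|%:R))).
  rewrite mulrA [X in _ <= X * _]mulrC !natrM natrX natrD.
  rewrite -!mulrA !ler_wpM2l ?ler0n ?exprn_ge0 ?ler0n //.
  rewrite [X in _ <= X]mulrA [X in X <= _]mulrC ler_wpM2r ?sqrtC_ge0 ?ler0n //.
  have IR : #|I|%:R <= m%:R :> algC by rewrite ler_nat.
  have : 0 <= (m%:R - #|I|%:R) + (1 - m%:R * sg) by rewrite addr_ge0 // subr_ge0.
  by rewrite -[X in _ -> is_true X]subr_ge0; congr (0 <= _); ring.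
by rewrite ler_pM2l.
Qed.

End Sieve.

(** * The action of polynomials through the Frobenius map *)

Lemma size_mul_pred (R : idomainType) (p s : {poly R}) : p != 0 -> s != 0 ->
  (size (p * s)).-1 = ((size p).-1 + (size s).-1)%N.
Proof.
move=> p0 s0; rewrite size_mul //; move: p0 s0; rewrite -!size_poly_gt0.
by case: (size p) (size s) => [|u] [|v] //= _ _; rewrite addnS.
Qed.

(** Fibers of a map [f] which on the subgroup [A] has the same fibers as the
    quotient map by the subgroup [H]. *)
Section FiberCount.
Variables (E : finZmodType) (T : finType) (A H : {set E}) (f : E -> T).
Hypothesis AB : {in A &, forall x y, x - y \in A}.
Hypothesis HA : H \subset A.
Hypothesis fH : {in A &, forall x y, (f x == f y) = (x - y \in H)}.

Lemma card_fiber y : y \in f @: A -> #|[set x in A | f x == y]| = #|H|.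
Proof.
move=> /imsetP[x0 x0A ->].
have A0 : 0 \in A by rewrite -(subrr x0) AB.
have AN x : x \in A -> - x \in A by move=> xA; rewrite -sub0r AB.
rewrite -(card_imset H (addIr x0)); apply: eq_card => x; rewrite inE.
apply/andP/imsetP => [[xA]|[u uH ->]].
  by rewrite fH // => xH; exists (x - x0); rewrite ?subrK.
have uA := fintype.subsetP HA u uH.
have uxA : u + x0 \in A by rewrite -[x0]opprK AB ?AN.
by rewrite fH // addrK.
Qed.

Lemma card_image_kernel : (#|f @: A| * #|H|)%N = #|A|.
Proof.
rewrite -[in RHS]sum1_card (partition_big_imset f) /= -sum_nat_const.
apply: eq_bigr => y yA; rewrite -(card_fiber yA) -sum1_card.
by apply: eq_bigl => x; rewrite inE.
Qed.
End FiberCount.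

Section FrobeniusAction.
Variables (F E : finFieldType) (iota : {rmorphism F -> E}) (n : nat).
Local Notation q := #|F|.
Implicit Types (p s : {poly F}) (a x y : E).
Hypothesis cardEn : #|E| = (q ^ n)%N.

Let q1 : (1 < q)%N := finNzRing_gt1 F.
Let q0 : (0 < q)%N := ltnW q1.

Lemma pchar_nat_card i : ([pchar E]).-nat (q ^ i)%N.
Proof.
have [p pp pF] := finPcharP F.
have pE : p \in [pchar E] by rewrite (fmorph_pchar iota).
rewrite pnatX; apply/orP; left; rewrite (eq_pnat _ (pcharf_eq pE)).
by have := card_pprimeChar pF; rewrite -[#|_|]/q => ->; rewrite pnatX pnat_id.
Qed.

(** The map [x |-> x ^ q].  The unused embedding makes the ring morphism
    structure, whose proof needs [E] to have the characteristic of [F],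
    inferable from the term. *)
Definition frobenius (_ : {rmorphism F -> E}) (x : E) : E := x ^+ q.
Local Notation frob := (frobenius iota).

Lemma frob_zmod : zmod_morphism frob.
Proof.
move=> x y; rewrite /frobenius -[q]expn1 exprDn_pchar ?pchar_nat_card //.
by congr (_ + _); rewrite exprNn_pchar ?pchar_nat_card.
Qed.

Lemma frob_monoid : monoid_morphism frob.
Proof. by split=> [|x y]; rewrite /frobenius ?expr1n // exprMn. Qed.

HB.instance Definition _ := GRing.isZmodMorphism.Build E E frob frob_zmod.
HB.instance Definition _ := GRing.isMonoidMorphism.Build E E frob frob_monoid.

Lemma frob_iota c : frob (iota c) = iota c.
Proof. by rewrite /frobenius -rmorphXn /= expf_card. Qed.

Lemma exprX_frob (x : E) i : x ^+ (q ^ i) = iter i frob x.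
Proof. by elim: i => [|i IH] //=; rewrite expnSr exprM IH. Qed.

(** The elements fixed by the Frobenius map are those of [F], since ['X^q - 'X]
    has at most [q] roots. *)
Lemma frob_fixed (x : E) : frob x = x -> exists c, x = iota c.
Proof.
move=> fx; have [/codomP[c ->]|xF] := boolP (x \in codom iota); first by exists c.
pose P : {poly E} := 'X^q - 'X.
have sP : size P = q.+1.
  by rewrite /P size_polyDl ?size_polyXn // size_polyN size_polyX.
have P0 : P != 0 by rewrite -size_poly_eq0 sP.
have := @max_poly_roots _ P (x :: codom iota) P0.
rewrite /= sP size_codom ltnS ltnn => h.
suff : false by []. apply: h.
  rewrite /root !hornerE -[x ^+ q]/(frob x) fx subrr eqxx /=.
  apply/allP => _ /codomP[c ->].
  by rewrite /root !hornerE -[_ ^+ q]/(frob _) frob_iota subrr.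
by rewrite xF /= map_inj_uniq ?enum_uniq //; apply: fmorph_inj.
Qed.

Lemma iter_frob_dim x : iter n frob x = x.
Proof. by rewrite -exprX_frob -cardEn expf_card. Qed.

(** The action of [F[X]] on [E] in which ['X] acts as the Frobenius map: the
    value at [a] of the linearized polynomial associated with [p]. *)
Definition act (p : {poly F}) (a : E) : E :=
  \sum_(i < size p) iota p`_i * iter i frob a.

Lemma act_wide m p a : (size p <= m)%N ->
  act p a = \sum_(i < m) iota p`_i * iter i frob a.
Proof.
move=> pm; rewrite /act (big_ord_widen m (fun i => iota p`_i * iter i frob a)) //.
rewrite big_mkcond; apply: eq_bigr => i _; case: ltnP => // h.
by rewrite nth_default // rmorph0 mul0r.
Qed.

Lemma iter_frobB i x y : iter i frob (x - y) = iter i frob x - iter i frob y.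
Proof. by elim: i => //= i ->; rewrite rmorphB. Qed.

Lemma act_sub p x y : act p (x - y) = act p x - act p y.
Proof. by rewrite -sumrB; apply: eq_bigr => i _; rewrite iter_frobB mulrBr. Qed.

Lemma act_zero p : act p 0 = 0.
Proof. by have := act_sub p 0 0; rewrite !subrr. Qed.

Lemma actD p s a : act (p + s) a = act p a + act s a.
Proof.
pose m := maxn (size p) (size s).
rewrite (@act_wide m) ?size_polyD // (@act_wide m p) ?leq_maxl //.
rewrite (@act_wide m s) ?leq_maxr // -big_split /=; apply: eq_bigr => i _.
by rewrite coefD rmorphD mulrDl.
Qed.

Lemma actZ c p a : act (c *: p) a = iota c * act p a.
Proof.
rewrite (@act_wide (size p)) ?size_scale_leq // /act mulr_sumr.
by apply: eq_bigr => i _; rewrite coefZ rmorphM mulrA.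
Qed.

Lemma act0 a : act 0 a = 0.
Proof. by rewrite /act size_poly0 big_ord0. Qed.

Lemma act1 a : act 1 a = a.
Proof. by rewrite /act size_poly1 big_ord1 coef1 rmorph1 mul1r. Qed.

Lemma actB p s a : act (p - s) a = act p a - act s a.
Proof. by rewrite -scaleN1r actD actZ rmorphN1 mulN1r. Qed.

Lemma actMX p a : act (p * 'X) a = frob (act p a).
Proof.
rewrite (@act_wide (size p).+1); last first.
  by apply: leq_trans (size_polyMleq _ _) _; rewrite size_polyX addn2.
rewrite big_ord_recl coefMX /= rmorph0 mul0r add0r /act rmorph_sum.
by apply: eq_bigr => i _; rewrite coefMX /= rmorphM /= frob_iota.
Qed.

Lemma actM p s a : act (p * s) a = act p (act s a).
Proof.
elim/poly_ind: p => [|p c IH]; first by rewrite mul0r !act0.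
rewrite mulrDl mulrAC mul_polyC !actD !actMX IH actZ.
by rewrite -[c%:P]mulr1 mul_polyC actZ act1.
Qed.

Lemma actXn i a : act 'X^i a = iter i frob a.
Proof. by elim: i => [|i IH]; rewrite ?expr0 ?act1 // exprSr actMX IH. Qed.

Lemma act_Xn_sub_1 a : act ('X^n - 1) a = 0.
Proof. by rewrite actB actXn act1 iter_frob_dim subrr. Qed.

Definition ker_act (p : {poly F}) : {set E} := [set a | act p a == 0].

Lemma ker_actB p : {in ker_act p &, forall x y, x - y \in ker_act p}.
Proof.
by move=> x y; rewrite !inE => /eqP hx /eqP hy; rewrite act_sub hx hy subrr.
Qed.

Lemma ker_act0 p : 0 \in ker_act p.
Proof. by rewrite inE act_zero. Qed.

Lemma ker_act_dvd p s : p %| s -> ker_act p \subset ker_act s.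
Proof.
move=> /dvdpP[u ->]; apply/fintype.subsetP => a; rewrite !inE => /eqP h.
by rewrite actM h act_zero.
Qed.

(** A linearized polynomial has at most as many roots as its degree. *)
Lemma card_ker_act_le p : p != 0 -> (#|ker_act p| <= q ^ (size p).-1)%N.
Proof.
move=> p0; pose P : {poly E} := \sum_(i < size p) iota p`_i *: 'X^(q ^ i).
have sp : (0 < size p)%N by rewrite size_poly_gt0.
have cP : P`_(q ^ (size p).-1) != 0.
  rewrite coef_sum; case: (size p) sp (lead_coefE p) => // m _ lE.
  rewrite big_ord_recr /= big1 ?add0r => [|i _].
    by rewrite coefZ coefXn eqxx mulr1 fmorph_eq0 -[m]/(m.+1.-1) -lE lead_coef_eq0.
  rewrite coefZ coefXn eqn_exp2l // gtn_eqF ?mulr0 //=.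
have P0 : P != 0 by apply: contraNneq cP => ->; rewrite coef0.
have sP : (size P <= (q ^ (size p).-1).+1)%N.
  apply: (leq_trans (size_sum _ _ _)); apply/bigmax_leqP => i _.
  apply: leq_trans (size_scale_leq _ _) _; rewrite size_polyXn ltnS leq_exp2l //.
  by rewrite -ltnS prednK.
rewrite cardE -ltnS; apply: leq_trans sP; apply: max_poly_roots P0 _ (enum_uniq _).
apply/allP => a; rewrite mem_enum inE => /eqP ap.
rewrite /root horner_sum -[X in _ == X]ap; apply/eqP; apply: eq_bigr => i _.
by rewrite !hornerE exprX_frob.
Qed.

Lemma n_gt0 : (0 < n)%N.
Proof. by case: n cardEn (finNzRing_gt1 E) => // ->. Qed.

Lemma Xn_sub_1_neq0 (R : nzRingType) : ('X^n - 1 : {poly R}) != 0.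
Proof. by rewrite -size_poly_gt0 size_XnsubC ?n_gt0. Qed.

(** With [s] the cofactor of [p] in ['X^n - 1], the image of [s] lies in the
    kernel of [p], and the product of the upper bounds for both kernels is [q ^ n]. *)
Lemma card_ker_act p : p %| 'X^n - 1 -> #|ker_act p| = (q ^ (size p).-1)%N.
Proof.
move=> /dvdpP[s e]; have X0 := Xn_sub_1_neq0 F.
have [p0 s0] : p != 0 /\ s != 0.
  by move: X0; rewrite e mulf_eq0 negb_or => /andP[-> ->].
apply/eqP; rewrite eqn_leq card_ker_act_le //=.
have szE : ((size p).-1 + (size s).-1 = n)%N.
  by rewrite addnC -size_mul_pred // -e size_XnsubC ?n_gt0.
have im : act s @: [set: E] \subset ker_act p.
  apply/fintype.subsetP => _ /imsetP[a _ ->]; rewrite inE -actM mulrC -e.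
  by rewrite act_Xn_sub_1.
have := @card_image_kernel E E [set: E] (ker_act s) (act s).
rewrite cardsT cardEn -szE expnD => h.
have {}h : (#|act s @: [set: E]| * #|ker_act s| = q ^ (size p).-1 * q ^ (size s).-1)%N.
  apply: h => [x y|//|x y _ _]; rewrite ?inE ?subsetT //.
  by rewrite act_sub subr_eq0.
rewrite -(@leq_pmul2r (q ^ (size s).-1)%N) ?expn_gt0 ?q0 // -h.
by apply: leq_mul; [apply: subset_leq_card | apply: card_ker_act_le].
Qed.

End FrobeniusAction.

(** * Irreducible factors and the Chinese remainder theorem *)

Section PolyFactors.
Variable F : fieldType.
Implicit Types (p g d h : {poly F}).

Lemma irreducible_divisor g : (1 < size g)%N ->
  exists2 d, irreducible_poly d & d %| g.
Proof.
move=> sg; pose P s := `[< exists d, [/\ size d = s, (1 < s)%N & d %| g] >].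
have exP : exists s, P s by exists (size g); apply/asboolP; exists g.
case: (ex_minnP exP) => s /asboolP[d [ds s1 dg]] smin; exists d => //.
split=> [|e e1 ed]; first by rewrite ds.
have d0 : d != 0 by rewrite -size_poly_gt0 ds ltnW.
have e0 : e != 0 by apply: contraNneq d0 => e0; rewrite -dvd0p -e0.
rewrite -dvdp_size_eqp // eqn_leq dvdp_leq //= ds; apply: smin.
apply/asboolP; exists e; split=> //; last exact: dvdp_trans ed dg.
by move: e0 e1; rewrite -size_poly_gt0; case: (size e) => [|[]].
Qed.

(** The irreducible factors of [g] up to associates and without
    multiplicities. *)
Lemma irreducible_factors g : g != 0 -> exists hs : seq {poly F},
  [/\ forall h, h \in hs -> irreducible_poly h /\ h %| g,
      uniq hs, {in hs &, forall h1 h2, h1 != h2 -> coprimep h1 h2}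
    & forall d, irreducible_poly d -> d %| g -> exists2 h, h \in hs & d %= h].
Proof.
have [s] := ubnP (size g); elim: s g => // s IH g; rewrite ltnS => gs g0.
have [g1|g1] := leqP (size g) 1.
  exists [::]; split=> // d [d1 _] /dvdp_leq -/(_ g0) dg.
  by have := leq_trans d1 (leq_trans dg g1).
have [h hI /dvdpP[u gu]] := irreducible_divisor g1.
have [u0 h0] : u != 0 /\ h != 0.
  by move: g0; rewrite gu mulf_eq0 negb_or => /andP[].
have [hs [hsI hsU hsC hsA]] : exists hs : seq {poly F},
  [/\ forall h, h \in hs -> irreducible_poly h /\ h %| u,
      uniq hs, {in hs &, forall h1 h2, h1 != h2 -> coprimep h1 h2}
    & forall d, irreducible_poly d -> d %| u -> exists2 h, h \in hs & d %= h].
  apply: (IH _ _ u0); apply: leq_trans gs; rewrite gu size_mul //.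
  have [h1 _] := hI; have su : (0 < size u)%N by rewrite size_poly_gt0.
  by move: (size u) (size h) su h1 => [|a] [|[|b]] //; lia.
have dhu d : irreducible_poly d -> d %| g -> d %= h \/ d %| u.
  move=> [d1 dI]; have [dh|dh] := boolP (d %| h).
    by left; apply: (hI.2) => //; rewrite gtn_eqF.
  rewrite gu Gauss_dvdpl; first by right.
  by rewrite irreducible_poly_coprime.
have [/hasP[h' h's hh']|/hasPn nh] := boolP (has (eqp h) hs).
  exists hs; split=> // [e /hsI[eI eu]|d dI].
    by split=> //; rewrite gu dvdp_mulr.
  move=> /(dhu _ dI)[dh|]; last exact: hsA.
  by exists h' => //; apply: eqp_trans dh hh'.
have coph e : e \in hs -> coprimep h e.
  move=> es; rewrite irreducible_poly_coprime //; apply/negP => he.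
  have [[_ eI] _] := hsI e es; have [h1 _] := hI.
  by have := nh e es; rewrite eI // gtn_eqF.
exists (h :: hs); split.
- move=> e; rewrite inE => /orP[/eqP->|/hsI[eI eu]]; split=> //.
    by rewrite gu dvdp_mull.
  by rewrite gu dvdp_mulr.
- by rewrite /= hsU andbT; apply/negP => /nh; rewrite eqpxx.
- move=> h1 h2; rewrite !inE => /orP[/eqP->|h1s] /orP[/eqP->|h2s].
  + by rewrite eqxx.
  + by move=> _; apply: coph.
  + by move=> _; rewrite coprimep_sym; apply: coph.
  by apply: hsC.
move=> d dI /(dhu _ dI)[dh|/(hsA _ dI)[e es de]].
  by exists h; rewrite ?mem_head.
by exists e; rewrite // inE es orbT.
Qed.

Lemma dvdp_prod_coprime (I : eqType) (s : seq I) (h : I -> {poly F}) g : uniq s ->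
  (forall i, i \in s -> h i %| g) ->
  {in s &, forall i j, i != j -> coprimep (h i) (h j)} ->
  \prod_(i <- s) h i %| g.
Proof.
elim: s => [|i s IH] /=; first by rewrite big_nil dvd1p.
move=> /andP[iNs us] hg hc; rewrite big_cons Gauss_dvdp.
  rewrite hg ?mem_head // IH // => [j js|j k js ks]; first by rewrite hg // inE js orbT.
  by apply: hc; rewrite inE ?js ?ks orbT.
rewrite big_seq; elim/big_ind: _ => [|x y hx hy|j js]; first exact: coprimep1.
  by rewrite coprimepMr hx.
apply: hc; rewrite ?mem_head // ?inE ?js ?orbT //.
by apply: contraNneq iNs => ->.
Qed.

Lemma size_prod_pred (I : eqType) (s : seq I) (h : I -> {poly F}) :
  (forall i, i \in s -> h i != 0) ->
  (size (\prod_(i <- s) h i)).-1 = (\sum_(i <- s) (size (h i)).-1)%N.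
Proof.
move=> h0; rewrite big_seq [in RHS]big_seq.
suff [] : \prod_(i <- s | i \in s) h i != 0 /\
  (size (\prod_(i <- s | i \in s) h i)).-1 = (\sum_(i <- s | i \in s) (size (h i)).-1)%N by [].
elim/big_rec2: _ => [|i m p /h0 hi [p0 IH]]; first by rewrite oner_neq0 size_poly1.
by rewrite mulf_neq0 // -IH size_mul_pred.
Qed.
End PolyFactors.

Section KernelSieve.
Variables (F E : finFieldType) (iota : {rmorphism F -> E}) (n : nat).
Local Notation q := #|F|.
Hypothesis cardEn : #|E| = (q ^ n)%N.
Variables (g : {poly F}) (I : finType) (h : I -> {poly F}).
Hypothesis gX : g %| 'X^n - 1.
Hypothesis h1 : forall i, (1 < size (h i))%N.
Hypothesis hg : forall i, h i %| g.
Hypothesis hc : forall i j, i != j -> coprimep (h i) (h j).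

Local Notation act := (act iota).
Local Notation ker_act := (ker_act iota).

Let g0 : g != 0.
Proof.
by apply: contraTneq gX => ->; rewrite dvd0p (Xn_sub_1_neq0 cardEn).
Qed.
Let hsg : \prod_i h i %| g.
Proof. by apply: dvdp_prod_coprime (index_enum_uniq _) _ _ => // i j _ _; apply: hc. Qed.

(** The elements killed by [g] and by [g / h i] for all [i] in [s] are killed by
    [g] divided by the product of these [h i], by Bezout relations. *)
Lemma ker_act_joint (s : seq I) a : uniq s -> act g a = 0 ->
  (forall i, i \in s -> act (g %/ h i) a = 0) ->
  act (g %/ \prod_(i <- s) h i) a = 0.
Proof.
move=> us ag; elim: s us => [|i s IH] /=; first by rewrite big_nil divp1.
move=> /andP[iNs us] ha.
have sub : \prod_(j <- i :: s) h j %| g.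
  by apply: dvdp_prod_coprime => //=; [rewrite iNs | move=> j k _ _; apply: hc].
have cop : coprimep (h i) (\prod_(j <- s) h j).
  rewrite big_seq; elim/big_ind: _ => [|x y hx hy|j js]; first exact: coprimep1.
    by rewrite coprimepMr hx.
  by apply: hc; apply: contraNneq iNs => ->.
rewrite big_cons in sub *; set P := \prod_(j <- s) h j in sub cop IH *.
case/dvdpP: sub => c gc.
have hi0 : h i != 0 by rewrite -size_poly_gt0 ltnW.
have P0 : P != 0 by apply: contraNneq g0 => P0; rewrite gc P0 !mulr0.
have e1 : act (c * P) a = 0.
  by rewrite -(ha i (mem_head _ _)) gc [h i * P]mulrC mulrA mulpK.
have e2 : act (c * h i) a = 0.
  rewrite -IH //; first by rewrite gc mulrA mulpK.
  by move=> j js; apply: ha; rewrite inE js orbT.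
have -> : g %/ (h i * P) = c by rewrite gc mulpK // mulf_neq0.
have /Bezout_eq1_coprimepP[[u v] /= uv] := cop.
have -> : c = u * (c * h i) + v * (c * P).
  by rewrite -[LHS]mulr1 -uv; ring.
by rewrite actD (actM _ u) (actM _ v) e1 e2 !act_zero addr0.
Qed.
(* The data of the sieve; [H] is the joint kernel in [A] of the maps [pi i]. *)
Let A := ker_act g.
Let pi i := act (g %/ h i).
Let K i := ker_act (h i).
Let P := \prod_i h i.
Let H := ker_act (g %/ P).
Let f (a : E) := [ffun i => pi i a].

Let h0 i : h i != 0.
Proof. by rewrite -size_poly_gt0 ltnW. Qed.

Let P0 : P != 0.
Proof. by apply/prodf_neq0 => i _. Qed.

Let HP : H \subset A.
Proof. by apply: ker_act_dvd; apply/dvdpP; exists P; rewrite mulrC divpK. Qed.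

Let fP : {in A &, forall x y, (f x == f y) = (x - y \in H)}.
Proof.
move=> x y xA yA; apply/eqP/idP => [e|].
  rewrite inE; apply/eqP; apply: ker_act_joint (index_enum_uniq _) _ _ => [|i _].
    by have := ker_actB xA yA; rewrite inE => /eqP.
  by rewrite act_sub; have /ffunP/(_ i) := e; rewrite !ffunE /pi => ->; rewrite subrr.
rewrite inE => /eqP e; apply/ffunP => i; rewrite !ffunE; apply/eqP.
rewrite -subr_eq0 -act_sub.
have -> : g %/ h i = \prod_(j | j != i) h j * (g %/ P).
  apply: (mulfI (h0 i)); rewrite mulrC divpK // mulrA.
  have -> : h i * \prod_(j | j != i) h j = P by rewrite /P [RHS](bigD1 i).
  by rewrite mulrC divpK.
by rewrite actM e act_zero.
Qed.

Let hX i : h i %| 'X^n - 1.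
Proof. exact: dvdp_trans (hg i) gX. Qed.

Let cardK i : #|K i| = (q ^ (size (h i)).-1)%N.
Proof. exact: (card_ker_act iota cardEn (hX i)). Qed.

Let cardA : #|A| = (q ^ (size g).-1)%N.
Proof. exact: (card_ker_act iota cardEn gX). Qed.

Let fK : f @: A \subset family (fun i => mem (K i)).
Proof.
apply/fintype.subsetP => _ /imsetP[x xA ->]; apply/familyP => i; rewrite ffunE inE.
rewrite -actM mulrC divpK //; by move: xA; rewrite inE.
Qed.

Let degP : (size P).-1 = (\sum_i (size (h i)).-1)%N.
Proof. exact: size_prod_pred. Qed.

Let degg : ((size (g %/ P)%R).-1 + (size P).-1 = (size g).-1)%N.
Proof.
have gP : g %/ P * P = g by rewrite divpK.
have gP0 : g %/ P != 0 by apply: contraNneq g0 => e; rewrite -gP e mul0r.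
by rewrite -size_mul_pred // gP.
Qed.

Let q0 : (0 < q)%N := ltnW (finNzRing_gt1 F).

(* Surjectivity onto the product of the [K i], by counting. *)
Let imK : f @: A = [set z in family (fun i => mem (K i))].
Proof.
apply/eqP; rewrite eqEcard; apply/andP; split.
  by apply/fintype.subsetP => z zA; rewrite inE (fintype.subsetP fK).
have cH : #|H| = (q ^ (size (g %/ P)%R).-1)%N.
  apply: (card_ker_act iota cardEn); apply: dvdp_trans gX.
  by apply/dvdpP; exists P; rewrite mulrC divpK.
have := card_image_kernel (@ker_actB _ _ iota g) HP fP.
rewrite cardA cH -degg expnD mulnC => /eqP; rewrite eqn_pmul2l ?expn_gt0 ?q0 //.
move=> /eqP ->; rewrite degP cardsE -sum1_card.
rewrite (eq_bigr (fun=> \prod_(i : I) 1)%N) => [|z _]; last by rewrite big1.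
rewrite -(bigA_distr_big_dep (fun i => [in K i]) (fun _ _ => 1%N)).
rewrite expn_sum leq_prod // => i _.
by rewrite sum1_card cardK.
Qed.

Let fiber (z : {ffun I -> E}) : (forall i, z i \in K i) ->
  #|[set v in A | [ffun i => pi i v] == z]| = #|H|.
Proof.
move=> zK; apply: (@card_fiber _ _ A H f (@ker_actB _ _ iota g) HP fP).
by rewrite imK inE; apply/familyP.
Qed.

Let K_ge i : (q <= #|K i|)%N.
Proof.
rewrite cardK -[X in (X <= _)%N]expn1 leq_pexp2l //.
by rewrite -ltnS prednK // ltnW.
Qed.

Let I_le : (#|I| <= (size g).-1)%N.
Proof.
rewrite -degg degP; apply: leq_trans (leq_addl _ _).
rewrite -sum1_card; apply: leq_sum => i _; rewrite -ltnS prednK //.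
exact: ltnW.
Qed.

(** The factor [q ^ n] is the order of [E], and [q ^ m] that of the kernel of
    [g]. *)
Theorem kernel_sieve (r M : nat) (m := (size g).-1) :
  #|E|.-1 = (r * M)%N ->
  (((r * 2 ^ size (primes M) * 2 ^ m) ^ 2 * q ^ n <= (q ^ m) ^ 2)%N \/
   [/\ (1 < m)%N, (m ^ 2 <= q)%N &
     ((r * 2 ^ size (primes M) * (m + 2)) ^ 2 * q ^ n <= (q ^ m) ^ 2)%N]) ->
  exists a, [/\ M.-primitive_root a, act g a = 0
              & forall i, act (g %/ h i) a != 0].
Proof.
move=> eM hyp.
suff [v] : exists2 v, v \in A & (forall i, pi i v != 0) /\ M.-primitive_root v.
  by rewrite inE => /eqP gv [hv Mv]; exists v.
have piB i : {morph pi i : x y / x - y} by move=> x y; apply: act_sub.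
have piK i : {in A, forall v, pi i v \in K i}.
  move=> v; rewrite !inE => /eqP e; by rewrite -actM mulrC divpK // e.
have K1 i : (1 < #|K i|)%N := leq_trans (finNzRing_gt1 F) (K_ge i).
case: hyp => [hyp|[m1 mq hyp]].
- apply: (@sieve_full _ r M eM A I pi K #|H|) => //.
  + exact: ker_act0.
  + exact: ker_actB.
  + by move=> i; apply: ker_act0.
  rewrite cardA cardEn; apply: leq_trans hyp.
  by rewrite leq_mul2r leq_exp2r // leq_mul2l leq_exp2l // I_le !orbT.
- apply: (@sieve_linear _ r M eM A I pi K #|H| _ _ _ _ _ _ _ m q) => //.
  + exact: ker_act0.
  + exact: ker_actB.
  + by move=> i; apply: ker_act0.
  by rewrite cardA cardEn.
Qed.
End KernelSieve.

(** * Annihilators and k-normality *)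

Section Normality.
Variables (F E : finFieldType) (iota : {rmorphism F -> E}) (n : nat).
Local Notation q := #|F|.
Hypothesis cardEn : #|E| = (q ^ n)%N.
Local Notation act := (act iota).
Local Notation frob := (frobenius iota).

(** An element of order [M] whose annihilator is generated by [g]: avoiding the
    kernels of [g / h] for the irreducible factors [h] of [g] is enough. *)
Theorem exists_prim_generator (g : {poly F}) (r M : nat) (m := (size g).-1) :
  g %| 'X^n - 1 -> #|E|.-1 = (r * M)%N ->
  (((r * 2 ^ size (primes M) * 2 ^ m) ^ 2 * q ^ n <= (q ^ m) ^ 2)%N \/
   [/\ (1 < m)%N, (m ^ 2 <= q)%N &
     ((r * 2 ^ size (primes M) * (m + 2)) ^ 2 * q ^ n <= (q ^ m) ^ 2)%N]) ->
  exists a, [/\ M.-primitive_root a, act g a = 0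
              & forall p, p %| g -> act p a = 0 -> p %= g].
Proof.
move=> gX eM hyp.
have g0 : g != 0.
  by apply: contraTneq gX => ->; rewrite dvd0p (Xn_sub_1_neq0 cardEn).
have [hs [hsI hsU hsC hsA]] := irreducible_factors g0.
pose h (i : 'I_(size hs)) := tnth (in_tuple hs) i.
have hin i : h i \in hs by exact: mem_tnth.
have h1 i : (1 < size (h i))%N by have [[]] := hsI _ (hin i).
have hg i : h i %| g by have [] := hsI _ (hin i).
have hc i j : i != j -> coprimep (h i) (h j).
  move=> ij; apply: hsC; rewrite ?hin //; apply: contraNneq ij.
  by rewrite /h !(tnth_nth 0) /= => /eqP; rewrite nth_uniq.
have [a [aM ag ah]] := kernel_sieve iota cardEn gX h1 hg hc eM hyp.
exists a; split=> // p /dvdpP[u gu] pa.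
have [u0 p0] : u != 0 /\ p != 0.
  by move: g0; rewrite gu mulf_eq0 negb_or => /andP[].
have [u1|u1] := leqP (size u) 1.
  rewrite gu -[p]mul1r mulrA mulr1; apply: eqp_mulr; rewrite eqp_sym -size_poly_eq1.
  by rewrite eqn_leq u1 size_poly_gt0.
have [d dI du] := irreducible_divisor u1.
have [e es de] : exists2 h, h \in hs & d %= h.
  by apply: hsA => //; rewrite gu dvdp_mulr.
have /dvdpP[v uv] : e %| u by rewrite -(eqp_dvdl _ de).
have e0 : e != 0 by apply: contraNneq u0 => e0; rewrite uv e0 mulr0.
have /tnthP[i ei] : e \in in_tuple hs by [].
have := ah i; rewrite /h -ei gu uv mulrAC mulpK // actM pa act_zero eqxx //.
Qed.

(** The polynomial [g_a = \sum_(i < n) a ^ (q ^ i) X ^ (n - 1 - i)]. *)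
Definition frob_poly (a : E) : {poly E} :=
  \sum_(i < n) iter i frob a *: 'X^(n - 1 - i).

Lemma frob_polyB x y : frob_poly (x - y) = frob_poly x - frob_poly y.
Proof. by rewrite -sumrB; apply: eq_bigr => i _; rewrite iter_frobB scalerBl. Qed.

Lemma frob_poly0 : frob_poly 0 = 0.
Proof. by have := frob_polyB 0 0; rewrite !subrr. Qed.

Lemma frob_polyD x y : frob_poly (x + y) = frob_poly x + frob_poly y.
Proof.
have := frob_polyB (x + y) y; rewrite addrK => ->; by rewrite subrK.
Qed.

Lemma frob_polyZ c x : frob_poly (iota c * x) = iota c *: frob_poly x.
Proof.
rewrite scaler_sumr; apply: eq_bigr => i _; rewrite scalerA; congr (_ *: _).
elim: (val i) => //= j ->; by rewrite rmorphM /= frob_iota.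
Qed.

Let n0 : (0 < n)%N := n_gt0 cardEn.

Lemma frob_poly_eq0 a : frob_poly a = 0 -> a = 0.
Proof.
move=> /(congr1 (fun p : {poly E} => p`_(n - 1))); rewrite coef0 coef_sum.
rewrite (bigD1 (Ordinal n0)) //= coefZ coefXn subn0 eqxx mulr1.
rewrite big1 ?addr0 // => i; rewrite -val_eqE /= => i0.
rewrite coefZ coefXn; case: eqP => [|_]; last by rewrite mulr0.
have := ltn_ord i; lia.
Qed.

Lemma size_frob_poly a : (size (frob_poly a) <= n)%N.
Proof.
apply: leq_trans (size_sum _ _ _) _; apply/bigmax_leqP => i _.
apply: leq_trans (size_scale_leq _ _) _; rewrite size_polyXn.
have := ltn_ord i; lia.
Qed.

Local Notation XN := ('X^n - 1 : {poly E}).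

(** Multiplying [g_a] by ['X] modulo ['X^n - 1] amounts to replacing [a] by its
    image under the Frobenius map. *)
Lemma frob_polyX a : 'X * frob_poly a - frob_poly (frob a) = a *: XN.
Proof.
pose u i := iter i frob a *: 'X^(n - i) : {poly E}.
rewrite /frob_poly mulr_sumr -sumrB.
transitivity (\sum_(0 <= i < n) (u i - u i.+1)); last first.
  rewrite (telescope_sumr_eq (fun i => - u i)) //; last by move=> i _; rewrite opprK addrC.
  rewrite opprK addrC /u subn0 subnn (iter_frob_dim iota cardEn) scalerBr expr0.
  by rewrite alg_polyC.
rewrite big_mkord; apply: eq_bigr => i _; rewrite /u -scalerAr -exprS -iterSr.
by congr (_ *: 'X^_ - _ *: 'X^_); have := ltn_ord i; lia.
Qed.

(** Consequently [p * g_a] is [g_b] with [b = act p a], modulo ['X^n - 1]. *)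
Lemma frob_poly_act p a :
  XN %| map_poly iota p * frob_poly a - frob_poly (act p a).
Proof.
elim/poly_ind: p => [|p c IH].
  by rewrite rmorph0 mul0r act0 frob_poly0 subrr dvdp0.
rewrite actD actMX frob_polyD -[c%:P]mulr1 mul_polyC actZ act1 frob_polyZ.
rewrite rmorphD rmorphM /= map_polyX map_polyZ rmorph1 mulrDl.
rewrite -scalerAl mul1r.
rewrite opprD addrACA subrr addr0.
have -> : map_poly iota p * 'X * frob_poly a - frob_poly (frob (act p a)) =
  'X * (map_poly iota p * frob_poly a - frob_poly (act p a)) +
  ('X * frob_poly (act p a) - frob_poly (frob (act p a))) by ring.
by apply: dvdp_add; rewrite ?frob_polyX -?mul_polyC dvdp_mull.
Qed.

Lemma map_frob_poly a : map_poly frob (frob_poly a) = frob_poly (frob a).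
Proof.
rewrite rmorph_sum; apply: eq_bigr => i _ /=.
by rewrite map_polyZ /= map_polyXn -iterSr.
Qed.

(** The polynomials [p] over [E] with [p * g_a] divisible by ['X^n - 1] are the
    multiples of [P], the monic associate of the quotient of ['X^n - 1] by its
    gcd with [g_a].  This set is stable under the Frobenius map on
    coefficients, so [P] has coefficients in [F].  Over [F], the condition on
    [p] means that [p] kills [a], so [P] is associate to [g]. *)
Theorem size_gcd_frob_poly (g : {poly F}) a : g %| 'X^n - 1 -> act g a = 0 ->
  (forall p, p %| g -> act p a = 0 -> p %= g) ->
  size (gcdp XN (frob_poly a)) = (n - (size g).-1).+1.
Proof.
move=> gX ga gmin; set G := gcdp _ _.
have X0 : XN != 0 := Xn_sub_1_neq0 cardEn E.
have XG : XN = XN %/ G * G by rewrite divpK ?dvdp_gcdl.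
have P0 : XN %/ G != 0 by apply: contraNneq X0 => e; rewrite XG e mul0r.
have G0 : G != 0 by apply: contraNneq X0 => e; rewrite XG e mulr0.
pose c := lead_coef (XN %/ G).
have c0 : c != 0 by rewrite lead_coef_eq0.
pose P := c^-1 *: (XN %/ G).
have PE : P %= XN %/ G by apply: eqp_scale; rewrite invr_eq0.
have Pmon : lead_coef P = 1 by rewrite lead_coefZ mulVf.
have ann p : (XN %| p * frob_poly a) = (P %| p).
  have cop : coprimep (XN %/ G) (frob_poly a %/ G).
    by apply: coprimep_div_gcd; rewrite X0.
  rewrite (eqp_dvdl _ PE) -[RHS](Gauss_dvdpl p cop) -[RHS](dvdp_mul2r _ _ G0).
  by rewrite -XG -mulrA divpK // dvdp_gcdr.
have Xfrob : map_poly frob XN = XN.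
  by rewrite rmorphB /= map_polyXn rmorph1.
have Pfrob : map_poly frob P = P.
  have sz : size (map_poly frob P) = size P by apply: size_map_poly.
  have : P %| map_poly frob P.
    rewrite -ann; have : XN %| P * frob_poly a by rewrite ann.
    rewrite -(dvdp_map (frob : {rmorphism E -> E})) Xfrob rmorphM /= map_frob_poly.
    have -> : frob_poly (frob a) = 'X * frob_poly a - a *: XN.
      by rewrite -frob_polyX opprB addrCA subrr addr0.
    rewrite mulrBr dvdp_subl; last by rewrite -mul_polyC !dvdp_mull.
    rewrite mulrCA Gauss_dvdpr // coprimep_sym.
    rewrite /XN coprimep_sym; apply/Bezout_eq1_coprimepP.
    exists (- 1, 'X^(n.-1)) => /=.
    by rewrite -exprSr prednK // mulN1r opprB subrK.
  move=> PP; apply/esym/eqP; rewrite -eqp_monic ?monicE ?Pmon //.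
    by rewrite -dvdp_size_eqp // sz.
  by rewrite lead_coef_map Pmon rmorph1.
have [p0 pP] : exists p0 : {poly F}, P = map_poly iota p0.
  have cf i : exists b, P`_i == iota b.
    have Pi : frob P`_i = P`_i by rewrite -[in RHS]Pfrob coef_map.
    have [b ->] := frob_fixed Pi.
    by exists b.
  exists (\poly_(i < size P) xchoose (cf i)).
  apply/polyP => i; rewrite coef_map coef_poly; case: ltnP => [_|h].
    exact: (eqP (xchooseP (cf i))).
  by rewrite nth_default; first exact: esym (rmorph0 iota).
have Xmap : XN = map_poly iota ('X^n - 1).
  by rewrite rmorphB /= map_polyXn rmorph1.
have p0g : p0 %| g.
  rewrite -(dvdp_map iota) -pP -ann.
  by have := frob_poly_act g a; rewrite ga frob_poly0 subr0.
have p0a : act p0 a = 0.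
  apply: frob_poly_eq0; apply/eqP; apply: contraT => ne0.
  have d1 : XN %| map_poly iota p0 * frob_poly a by rewrite ann pP.
  have := dvdp_sub d1 (frob_poly_act p0 a).
  rewrite opprB addrCA subrr addr0 => /dvdp_leq -/(_ ne0).
  rewrite size_XnsubC // => /leq_trans -/(_ _ (size_frob_poly _)).
  by rewrite ltnn.
have sg : size g = size (XN %/ G).
  rewrite -(eqp_size (gmin _ p0g p0a)) -(eqp_size PE) pP.
  by rewrite size_map_poly.
have : (size XN).-1 = n by rewrite size_XnsubC.
rewrite sg {1}XG size_mul_pred // => e; rewrite -[X in (X - _)%N]e.
by rewrite addKn prednK // size_poly_gt0.
Qed.
End Normality.

(** * Bounding the number of squarefree divisors *)

Section RealBounds.
Variables (R : realType) (t : R).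
Hypothesis t0 : 0 < t.

Lemma powRVK (x : R) : 0 <= x -> (x `^ t) `^ t^-1 = x.
Proof. by move=> x0; rewrite -powRrM divff ?gt_eqF // powRr1. Qed.

(** Writing [G p = 2 / p ^ (1 / t)], the product of the [G p] over the primes of
    [M] only grows if the primes [p >= 2 ^ t], for which [G p <= 1], are left
    out and all the primes [p < 2 ^ t], for which [G p >= 1], are put in. *)
Lemma pow2_size_primes_le M : (0 < M)%N ->
  2 ^+ size (primes M) <= A_ t * M%:R `^ t^-1.
Proof.
move=> M0; pose G p : R := 2 / p%:R `^ t^-1.
have pgt0 p : prime p -> 0 < p%:R `^ t^-1 :> R.
  by move=> pp; rewrite powR_gt0 // ltr0n prime_gt0.
have Gge0 p : 0 <= G p by rewrite divr_ge0 // powR_ge0.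
have ti0 : 0 <= t^-1 by rewrite invr_ge0 ltW.
have Mge : \prod_(p <- primes M) p%:R `^ t^-1 <= M%:R `^ t^-1 :> R.
  rewrite (_ : \prod_(p <- _) _ = (\prod_(p <- primes M) p)%:R `^ t^-1).
    apply: ge0_ler_powR; rewrite ?nnegrE ?ler0n // ler_nat dvdn_leq //.
    rewrite {2}[M]prod_prime_decomp // prime_decompE big_map /= big_seq [X in (_ %| X)%N]big_seq.
    elim/big_rec2: _ => // p0 a b pM ab; apply: dvdn_mul => //.
    by rewrite -[X in (X %| _)%N]expn1 dvdn_exp2l // logn_gt0.
  elim: (primes M) => [|p0 s IH]; first by rewrite !big_nil powR1.
  by rewrite !big_cons natrM powRM ?ler0n // IH.
have Gprod : 2 ^+ size (primes M) =
    \prod_(p <- primes M) G p * \prod_(p <- primes M) p%:R `^ t^-1.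
  rewrite -big_split /= (_ : 2 ^+ _ = \prod_(p <- primes M) 2); last first.
    by rewrite big_const_seq count_predT iter_mulr mulr1.
  rewrite big_seq [RHS]big_seq.
  by apply: eq_bigr => p; rewrite mem_primes => /and3P[pp _ _]; rewrite divfK ?gt_eqF ?pgt0.
have Gs0 : 0 <= \prod_(p <- primes M) G p by apply: prodr_ge0.
have ps0 : 0 <= \prod_(p <- primes M) p%:R `^ t^-1 :> R.
  by apply: prodr_ge0 => p _; apply: powR_ge0.
rewrite Gprod; apply: (ler_pM Gs0 ps0 _ Mge).
pose small p := p%:R < 2 `^ t :> R.
have G1 p : prime p -> small p -> 1 <= G p.
  move=> pp ps; rewrite /G ler_pdivlMr ?pgt0 // mul1r -[leRHS]powRVK //.
  by apply: ge0_ler_powR; rewrite ?nnegrE ?ler0n ?powR_ge0 // ltW.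
have Gle1 p : prime p -> ~~ small p -> G p <= 1.
  move=> pp; rewrite /small -leNgt => ps.
  rewrite /G ler_pdivrMr ?pgt0 // mul1r -[leLHS]powRVK //.
  by apply: ge0_ler_powR; rewrite ?nnegrE ?ler0n ?powR_ge0.
apply: (@le_trans _ _ (\prod_(p <- primes M | small p) G p)).
  rewrite [leRHS]big_mkcond /= big_seq [leRHS]big_seq.
  apply: ler_prod => p; rewrite mem_primes => /and3P[pp _ _].
  by rewrite Gge0 /=; case: ifP => // /negbT; apply: Gle1.
rewrite /A_ -[leRHS]/(\prod_(0 <= p < _ | prime p && small p) G p).
rewrite [leRHS](bigID [in primes M]) /=.
set P1 := \prod_(p <- primes M | _) _; set P2 := (X in _ <= X * _).
have -> : P1 = P2.
  rewrite /P1 /P2 -[LHS]big_filter -[RHS]big_filter; apply: perm_big.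
  apply: uniq_perm; rewrite ?filter_uniq ?primes_uniq ?iota_uniq // => p.
  rewrite !mem_filter mem_index_iota /=.
  have [pM|] := boolP (p \in primes M); last by rewrite !andbF.
  rewrite andbT; have := pM; rewrite mem_primes => /and3P[-> _ _] /=.
  rewrite andbT; have [ps|//] := boolP (small p).
  by rewrite ltnS truncn_ge_nat ?powR_ge0 // ltW.
rewrite -[X in X <= _]mulr1; apply: ler_wpM2l; first exact: prodr_ge0.
elim/big_ind: _ => // [x y x1 y1|p /andP[/andP[pp ps] _]]; last exact: G1.
by rewrite -[1]mulr1 ler_pM.
Qed.

(** Here [Y] is [2 ^ (n - k)] or [n - k + 2].  The inverse of the exponent is
    [(n - 2 k) / 2 - n / t], where the second term pays for [M ^ (1 / t)]. *)
Lemma real_threshold_sound (n k r Y q M : nat) :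
  2 * n%:R / (n%:R - 2 * k%:R) < t -> (2 * k < n)%N -> (0 < M <= q ^ n)%N ->
  (0 < q)%N -> (r%:R * Y%:R * A_ t) `^ UV_exponent t n k <= q%:R ->
  ((r * 2 ^ size (primes M) * Y) ^ 2 <= q ^ (n - 2 * k))%N.
Proof.
move=> tn kn /andP[M0 Mq] q0 hq.
have nk0 : 0 < n%:R - 2 * k%:R :> R by rewrite subr_gt0 -natrM ltr_nat.
have d0 : 0 < t * (n%:R - 2 * k%:R) - 2 * n%:R.
  by rewrite subr_gt0 -ltr_pdivrMr.
set e := UV_exponent t n k in hq.
have e0 : 0 < e by rewrite divr_gt0 // mulr_gt0.
have eV : e^-1 = (n%:R - 2 * k%:R) / 2 - n%:R / t.
  by rewrite /e /UV_exponent; field; rewrite !gt_eqF.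
have A0 : 0 <= A_ t.
  by apply: prodr_ge0 => p _; rewrite divr_ge0 // powR_ge0.
set X := r%:R * Y%:R * A_ t in hq.
have X0 : 0 <= X by rewrite !mulr_ge0.
have XV : X <= q%:R `^ e^-1.
  rewrite -[X](_ : (X `^ e) `^ e^-1 = X).
    by apply: ge0_ler_powR; rewrite ?nnegrE ?powR_ge0 ?ler0n ?invr_ge0 // ltW.
  by rewrite -powRrM divff ?gt_eqF // powRr1.
have qR : 0 < q%:R :> R by rewrite ltr0n.
have main : (r * 2 ^ size (primes M) * Y)%:R <= q%:R `^ ((n%:R - 2 * k%:R) / 2) :> R.
  apply: (@le_trans _ _ (X * M%:R `^ t^-1)).
    rewrite /X !natrM natrX -!mulrA ler_wpM2l ?ler0n // [leLHS]mulrC ler_wpM2l ?ler0n //.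
    exact: pow2_size_primes_le.
  rewrite [leRHS](_ : _ = q%:R `^ e^-1 * (q ^ n)%:R `^ t^-1).
    apply: ler_pM; rewrite ?powR_ge0 //.
    by apply: ge0_ler_powR; rewrite ?nnegrE ?ler0n ?invr_ge0 ?ler_nat // ltW.
  rewrite natrX -powR_mulrn ?ler0n // -powRrM -powRD ?eV ?subrK //.
  by rewrite (gt_eqF qR) implybT.
rewrite -(ler_nat R) !natrX -(powR_mulrn (n - 2 * k)) ?ler0n //.
apply: (@le_trans _ _ ((q%:R `^ ((n%:R - 2 * k%:R) / 2)) ^+ 2)).
  by rewrite ler_pXn2r // nnegrE ?ler0n ?powR_ge0.
rewrite -powR_mulrn ?powR_ge0 // -powRrM divfK // natrB ?natrM //.
exact: ltnW.
Qed.

End RealBounds.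

(** * Existence of r-primitive k-normal elements *)

(** The two criteria in terms of natural numbers, [2 ^ size (primes M)] being the
    number of squarefree divisors of [M]. *)
Theorem exists_rprimitive_knormal (F : finFieldType) (L : fieldExtType F)
    (k r : nat) (f : {poly F}) (n := \dim {:L}) (m := (n - k)%N)
    (M := ((#|F| ^ n - 1) %/ r)%N) :
  (0 < r)%N -> (r %| #|F| ^ n - 1)%N -> (2 * k < n)%N ->
  size f = k.+1 -> f %| 'X^n - 1 ->
  (((r * 2 ^ size (primes M) * 2 ^ m) ^ 2 <= #|F| ^ (n - 2 * k))%N \/
   [/\ (1 < m)%N, (m ^ 2 <= #|F|)%N &
     ((r * 2 ^ size (primes M) * (m + 2)) ^ 2 <= #|F| ^ (n - 2 * k))%N]) ->
  exists alpha : L, r_primitive r alpha /\ k_normal k alpha.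
Proof.
move=> r0 rq kn sf fX hyp.
have k_le : (k <= n)%N by lia.
have k_lt : (k <= n - 1)%N by lia.
have exp_eq : (m * 2 = n - 2 * k + n)%N by rewrite /m; lia.
(* The finite field structure of [L]. *)
pose E : finFieldType := finvect_type L.
have cardEn : #|E| = (#|F| ^ n)%N.
  pose cE := Vector.class (finvect_type L : vectType F).
  by rewrite -(@card_vspacef F (finvect_type L) cE) (@card_vspace F _ cE).
have eM : #|E|.-1 = (r * M)%N by rewrite cardEn /M mulnC divnK // subn1.
case/dvdpP: fX => g gX.
have X0 : ('X^n - 1 : {poly F}) != 0 := Xn_sub_1_neq0 cardEn F.
have [g0 f0] : g != 0 /\ f != 0.
  by move: X0; rewrite gX mulf_eq0 negb_or => /andP[].
have sg : (size g).-1 = m.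
  have : (size (g * f)).-1 = n by rewrite -gX size_XnsubC // (n_gt0 cardEn).
  by rewrite size_mul_pred // sf /m => <-; rewrite addnK.
have qe : ((#|F| ^ m) ^ 2 = #|F| ^ (n - 2 * k) * #|F| ^ n)%N.
  by rewrite -expnM -expnD exp_eq.
pose iota : {rmorphism F -> E} := in_alg L.
have gdX : g %| 'X^n - 1 by rewrite gX dvdp_mulr.
have hyp' : ((r * 2 ^ size (primes M) * 2 ^ (size g).-1) ^ 2 * #|F| ^ n
      <= (#|F| ^ (size g).-1) ^ 2)%N \/
   [/\ (1 < (size g).-1)%N, ((size g).-1 ^ 2 <= #|F|)%N &
     ((r * 2 ^ size (primes M) * ((size g).-1 + 2)) ^ 2 * #|F| ^ n
       <= (#|F| ^ (size g).-1) ^ 2)%N].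
  rewrite sg qe; case: hyp => [h|[m1 mq h]]; [left | right; split=> //];
  by rewrite leq_mul2r h orbT.
have [a [aM ga gmin]] := exists_prim_generator iota cardEn gdX eM hyp'.
exists a; split; first by rewrite /r_primitive rq.
rewrite /k_normal; apply/andP; split; first exact: k_lt.
have gp : @g_poly F L a = frob_poly iota n a.
  by apply: eq_bigr => i _; rewrite (exprX_frob iota).
rewrite [@g_poly F L a]gp.
have := size_gcd_frob_poly cardEn gdX ga gmin.
by rewrite sg => ->; rewrite /m subKn.
Qed.

Theorem proposition3p8 (R : realType) (q n k r : nat)
    (F : finFieldType) (L : fieldExtType F) (t : R) :
  #|F| = q -> \dim {:L} = n ->
  (0 < n)%N -> (0 < k)%N -> (0 < r)%N ->
  (r %| q ^ n - 1)%N ->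
  (2 * k < n)%N ->
  (exists f : {poly F}, size f = k.+1 /\ f %| 'X^n - 1) ->
  2 * n%:R / (n%:R - 2 * k%:R) < t ->
  Num.min (U_ t n k r) (Num.max ((n - k)%:R ^+ 2) (V_ t n k r)) <= q%:R ->
  exists alpha : L, r_primitive r alpha /\ k_normal k alpha.
Proof.
move=> qE nE n0 k0 r0 rq kn [f [sf fX]] tn hq.
have m_gt1 : (1 < n - k)%N.
  by rewrite ltn_subRL; apply: leq_ltn_trans kn; rewrite mul2n -addnn leq_add2l.
have q1 : (1 < q)%N by rewrite -qE finNzRing_gt1.
have t0 : 0 < t.
  apply: le_lt_trans tn; rewrite divr_ge0 // ?mulr_ge0 // subr_ge0 -natrM ler_nat.
  exact: ltnW.
have qn1 : (1 < q ^ n)%N by rewrite -[1%N](expn0 q) ltn_exp2l.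
pose M := ((q ^ n - 1) %/ r)%N.
have Mq : (0 < M <= q ^ n)%N.
  rewrite divn_gt0 // dvdn_leq ?subn_gt0 //=.
  by apply: leq_trans (leq_div _ _) _; rewrite leq_subr.
suff hyp : ((r * 2 ^ size (primes M) * 2 ^ (n - k)) ^ 2 <= q ^ (n - 2 * k))%N \/
   [/\ (1 < n - k)%N, ((n - k) ^ 2 <= q)%N &
     ((r * 2 ^ size (primes M) * (n - k + 2)) ^ 2 <= q ^ (n - 2 * k))%N].
  by subst q n; apply: exists_rprimitive_knormal r0 rq kn sf fX hyp.
move: hq; rewrite ge_min ge_max => /orP[hU|/andP[hm hV]]; [left|right; split=> //].
- apply: (real_threshold_sound t0 tn kn Mq (ltnW q1)).
  by rewrite natrX.
- by rewrite -(ler_nat R) natrX.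
exact: (real_threshold_sound t0 tn kn Mq (ltnW q1)).
Qed.
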